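(* Let $\mathcal{Q}$ be the space of quadrilaterals modulo similarity, topologized as a subset of $\mathbb{R}^4$ via the parameterization described in the context. For every rectangle $r\in\mathcal{Q}$ there exists an open set $U\subset\mathcal{Q}$ with $r\in U$ such that every quadrilateral in $U$ has a periodic billiard path.
   Context: Parameterization of $\mathcal{Q}$: a quadrilateral is cut by one of its diagonals into two triangles. Each triangle is determined up to similarity by its two angles at the endpoints of the diagonal. The four angles between the diagonal and the four sides, $(a,b,c,d)$, therefore determine the quadrilateral up to similarity, and $\mathcal{Q}$ is regarded as a subset of $\mathbb{R}^4$ in this way. The rectangles form the set $\{(a,b,c,d): a=c,\ b=d,\ a+b=\pi/2\}$. A billiard path in a polygon is the trajectory of a point that moves in straight lines inside the polygon and reflects off the sides with angle of incidence equal to angle of reflection. Trajectories that hit a vertex are excluded. A billiard path is periodic if it repeats itself. *)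

(* Defs.v *)
From Stdlib Require Import Reals Lra.
Open Scope R_scope.

Definition pt := (R * R)%type.

Definition padd (u v : pt) : pt := (fst u + fst v, snd u + snd v).
Definition psub (u v : pt) : pt := (fst u - fst v, snd u - snd v).
Definition pscale (s : R) (u : pt) : pt := (s * fst u, s * snd u).
Definition dot (u v : pt) : R := fst u * fst v + snd u * snd v.

Definition refl (w u : pt) : pt :=
  psub (pscale (2 * dot u w / dot w w) w) u.

(* The diagonal is the segment from A = (0,0) to C = (1,0).  The triangle
   ABC lies above it with angle a at A (between AC and AB) and angle b at C
   (between CA and CB); the triangle ACD lies below it with angle c at C
   (between CA and CD) and angle d at A (between AC and AD).  Going around
   the quadrilateral A B C D, (a,b,c,d) are the angles between the diagonal
   and the sides AB, BC, CD, DA respectively.  *)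
Definition in_Q (a b c d : R) : Prop :=
  0 < a /\ 0 < b /\ 0 < c /\ 0 < d /\ a + b < PI /\ c + d < PI.

Definition is_rectangle (a b c d : R) : Prop :=
  a = c /\ b = d /\ a + b = PI / 2.

(* Vertices (law of sines): |AB| = sin b / sin (a+b), |AD| = sin c / sin (c+d). *)
Definition vA : pt := (0, 0).
Definition vB (a b : R) : pt :=
  (sin b / sin (a + b) * cos a, sin b / sin (a + b) * sin a).
Definition vC : pt := (1, 0).
Definition vD (c d : R) : pt :=
  (sin c / sin (c + d) * cos d, - (sin c / sin (c + d) * sin d)).

Definition vert (a b c d : R) (i : nat) : pt :=
  match i with
  | 0%nat => vA
  | 1%nat => vB a b
  | 2%nat => vC
  | _ => vD c d
  end.

Definition on_open_seg (P Q x : pt) : Prop :=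
  exists t, 0 < t < 1 /\ x = padd (pscale (1 - t) P) (pscale t Q).

Definition in_open_triangle (P Q S x : pt) : Prop :=
  exists al be ga, 0 < al /\ 0 < be /\ 0 < ga /\ al + be + ga = 1 /\
    x = padd (pscale al P) (padd (pscale be Q) (pscale ga S)).

(* Interior of the quadrilateral: the two open triangles glued along the
   open diagonal AC (which lies inside the quadrilateral). *)
Definition in_interior (a b c d : R) (x : pt) : Prop :=
  in_open_triangle vA (vB a b) vC x \/
  in_open_triangle vA vC (vD c d) x \/
  on_open_seg vA vC x.

Definition seg_inside (a b c d : R) (p q : pt) : Prop :=
  forall t, 0 < t < 1 -> in_interior a b c d (padd (pscale (1 - t) p) (pscale t q)).

(* A periodic billiard path: a periodic sequence of bounce points p k, each
   in the relative interior of a side (so no vertex is hit), consecutive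
   bounce points joined by segments lying in the interior, and at each bounce
   angle of incidence = angle of reflection: the outgoing direction is the
   mirror image of the incoming direction in the side. *)
Definition has_periodic_billiard_path (a b c d : R) : Prop :=
  exists (p : nat -> pt) (n : nat),
    (0 < n)%nat /\
    (forall k, p (k + n)%nat = p k) /\
    (forall k, seg_inside a b c d (p k) (p (S k))) /\
    (forall k, exists j, (j < 4)%nat /\
       on_open_seg (vert a b c d j) (vert a b c d ((j + 1) mod 4)) (p (S k)) /\
       exists lam, 0 < lam /\
         psub (p (S (S k))) (p (S k)) =
         pscale lam (refl (psub (vert a b c d ((j + 1) mod 4)) (vert a b c d j))
                          (psub (p (S k)) (p k)))).

(* Main.v *)
(* Let the deficit of a vertex be pi/2 minus its interior angle; the four deficits
   are small and add up to 0.  If they all vanish the quadrilateral is a rectangle.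
   Otherwise some vertex P has deficit p > 0, and since the other three deficits
   average -p/3, another vertex Q has deficit q >= -p/3.  The periodic path stays
   close to the segment PQ, which may be a side or a diagonal.  Seen in the
   double of the quadrilateral, such a path runs around a slit PQ with cone points
   of angle pi - 2p and pi - 2q at its ends, so it depends on nothing but p, q and
   the side on which it passes each end.  Unfolding the slit gives a polygonal line,
   and a periodic sequence of sides is realized iff the total turning is 0 and some
   line parallel to the holonomy separates the vertices passed on one side from
   those passed on the other.  With + and - for the sides, these sequences work:
     q > 0:          P+ Q+ P- Q-
     q = 0:          P+ Q+ P- Q+
     -p/3 < q < 0:   P- Q+ P+ Q+ P+ Q- P- Q- P- Q- P- Q- P+ Q+ P+ Q+
     q = -p/3:       P+ Q- P- Q- P- Q-  *)

Require Import Defs.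
From Stdlib Require Import Reals.
From Stdlib Require Import Lra Lia Arith Relations.
Open Scope R_scope.

(** * Lipschitz bounds for sine and cosine *)

Lemma sin_le_abs (x : R) : Rabs (sin x) <= Rabs x.
Proof.
  assert (P : forall y, 0 <= y -> Rabs (sin y) <= y).
  { intros y Hy. destruct (Rle_lt_dec 1 y) as [H|H].
    - pose proof (SIN_bound y). apply Rabs_le; lra.
    - destruct (Req_dec y 0) as [->|N]; [rewrite sin_0, Rabs_R0; lra|].
      assert (0 < y) by lra. pose proof PI2_1. pose proof PI_RGT_0.
      rewrite Rabs_right; [left; now apply sin_lt_x|].
      apply Rle_ge, sin_ge_0; lra. }
  destruct (Rle_lt_dec 0 x) as [H|H].
  - rewrite (Rabs_right x) by lra. now apply P.
  - rewrite (Rabs_left x) by lra. rewrite <- (Ropp_involutive x), sin_neg, Rabs_Ropp, Ropp_involutive.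
    apply P; lra.
Qed.

Lemma sin_lipschitz (x y : R) : Rabs (sin x - sin y) <= Rabs (x - y).
Proof.
  rewrite form4, !Rabs_mult, (Rabs_right 2) by lra.
  pose proof (sin_le_abs ((x - y) / 2)) as H1.
  pose proof (COS_bound ((x + y) / 2)) as H2.
  assert (H3 : Rabs (cos ((x + y) / 2)) <= 1) by (apply Rabs_le; lra).
  unfold Rdiv in H1 at 2. rewrite Rabs_mult, (Rabs_right (/ 2)) in H1 by lra.
  pose proof (Rabs_pos (sin ((x - y) / 2))). pose proof (Rabs_pos (cos ((x + y) / 2))).
  nra.
Qed.

Lemma cos_lipschitz (x y : R) : Rabs (cos x - cos y) <= Rabs (x - y).
Proof.
  rewrite !cos_sin. replace (x - y) with (PI / 2 + x - (PI / 2 + y)) by ring.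
  apply sin_lipschitz.
Qed.

Lemma cos_ge_half (x : R) : Rabs x <= / 2 -> / 2 <= cos x.
Proof.
  intros H. pose proof (cos_lipschitz x 0) as K. rewrite cos_0, Rminus_0_r in K.
  pose proof (Rle_abs (- (cos x - 1))). rewrite Rabs_Ropp in H0. lra.
Qed.

Lemma pt_eq (u v : pt) : fst u = fst v -> snd u = snd v -> u = v.
Proof. destruct u, v; simpl; congruence. Qed.

(** * The pocket around a segment *)

(* A state records an endpoint of the segment ([true] for the second one), the
   side on which the path passes it, the angle [A] between the segment and the
   path after passing it (positive if the path approaches the line of the
   segment), and the distance [M] of the endpoint from the path, in units of the
   length of the segment.  [p] and [q]
   are the deficits of the two endpoints. *)
Definition pocket_state := (bool * bool * R * R)%type.

(** [M - sin A] is the signed distance of the other endpoint from the line of the path. If it is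
    positive, the path stays on its side of the segment; if it is negative, the path crosses the
    segment, and both distance and angle change sign. Going around a cone point of angle
    [PI - 2 * e] then adds [2 * e] to the angle. [B] bounds everything, so the path stays close to
    the segment. *)
Inductive pocket_step (p q B : R) : pocket_state -> pocket_state -> Prop :=
| pocket_same (b s : bool) (A M A' M' : R) :
    A' = A + 2 * (if b then p else q) -> M' = M - sin A ->
    0 < M <= B -> 0 < M' <= B -> Rabs A <= B -> Rabs A' <= B ->
    pocket_step p q B (b, s, A, M) (negb b, s, A', M')
| pocket_flip (b s : bool) (A M A' M' : R) :
    A' = - A + 2 * (if b then p else q) -> M' = sin A - M ->
    0 < M <= B -> 0 < M' <= B -> Rabs A <= B -> Rabs A' <= B ->
    pocket_step p q B (b, s, A, M) (negb b, negb s, A', M').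

Definition pocket_orbit (p q B : R) : Prop :=
  exists x, clos_trans pocket_state (pocket_step p q B) x x.

Lemma pocket_orbit_zero (B : R) : 0 < B -> pocket_orbit 0 0 B.
Proof.
  intros HB. exists (false, true, 0, B).
  apply t_trans with (true, true, 0, B); apply t_step.
  - apply (pocket_same _ _ _ false true); rewrite ?sin_0, ?Rabs_R0; lra.
  - apply (pocket_same _ _ _ true true); rewrite ?sin_0, ?Rabs_R0; lra.
Qed.

(** If [P Q] is a side, this is the Fagnano orbit, run twice, of the acute triangle bounded by the
    lines of [P Q] and its two neighbouring sides. *)
Lemma pocket_orbit_acute (p q B : R) :
  0 < p -> 0 < q -> p + q <= B -> B <= 1 / 2 -> pocket_orbit p q B.
Proof.
  intros Hp Hq H HB. pose proof PI2_1 as Hpi.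
  assert (S1 := sin_plus p q). assert (S2 := sin_minus p q).
  assert (0 < sin p < p) by (split; [apply sin_gt_0|apply sin_lt_x]; lra).
  assert (0 < sin q < q) by (split; [apply sin_gt_0|apply sin_lt_x]; lra).
  assert (0 < cos p) by (apply cos_gt_0; lra). assert (0 < cos q) by (apply cos_gt_0; lra).
  pose proof (COS_bound p). pose proof (COS_bound q).
  assert (M1 : 0 < sin p * cos q <= B) by (split; nra).
  assert (M2 : 0 < cos p * sin q <= B) by (split; nra).
  assert (A1 : Rabs (p - q) <= B) by (apply Rabs_le; lra).
  assert (A2 : Rabs (p + q) <= B) by (apply Rabs_le; lra).
  exists (false, true, p - q, sin p * cos q).
  apply t_trans with (true, true, p + q, cos p * sin q);
    [apply t_step, (pocket_same _ _ _ false true); lra|].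
  apply t_trans with (false, false, p - q, sin p * cos q);
    [apply t_step, (pocket_flip _ _ _ true true); lra|].
  apply t_trans with (true, false, p + q, cos p * sin q);
    [apply t_step, (pocket_same _ _ _ false false); lra|].
  apply t_step, (pocket_flip _ _ _ true false); lra.
Qed.

Lemma pocket_orbit_right (p B : R) :
  0 < p -> 2 * p <= B -> B <= 1 / 2 -> pocket_orbit p 0 B.
Proof.
  intros Hp H HB. pose proof PI2_1 as Hpi.
  assert (0 < sin p < p) by (split; [apply sin_gt_0|apply sin_lt_x]; lra).
  assert (A1 : Rabs p <= B) by (apply Rabs_le; lra).
  assert (A2 : Rabs (- p) <= B) by (apply Rabs_le; lra).
  assert (N := sin_neg p).
  (* The sequence closes for every initial distance, and all distances are positive between [sin p]
     and [2 * sin p]; this is the midpoint. *)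
  exists (false, true, p, 3 / 2 * sin p).
  apply t_trans with (true, true, p, / 2 * sin p);
    [apply t_step, (pocket_same _ _ _ false true); lra|].
  apply t_trans with (false, false, p, / 2 * sin p);
    [apply t_step, (pocket_flip _ _ _ true true); lra|].
  apply t_trans with (true, true, - p, / 2 * sin p);
    [apply t_step, (pocket_flip _ _ _ false false); lra|].
  apply t_step, (pocket_same _ _ _ true true); lra.
Qed.

Lemma pocket_orbit_third (v B : R) :
  0 < v -> 32 * v <= B -> B <= 1 / 2 -> pocket_orbit (3 * v) (- v) B.
Proof.
  intros Hv H HB. pose proof PI2_1 as Hpi.
  assert (0 < sin v < v) by (split; [apply sin_gt_0|apply sin_lt_x]; lra).
  assert (0 < sin (3 * v) < 3 * v) by (split; [apply sin_gt_0|apply sin_lt_x]; lra).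
  assert (0 < sin (5 * v) < 5 * v) by (split; [apply sin_gt_0|apply sin_lt_x]; lra).
  assert (sin v < sin (5 * v)) by (apply sin_increasing_1; lra).
  assert (N1 := sin_neg v). assert (N3 := sin_neg (3 * v)). assert (N5 := sin_neg (5 * v)).
  assert (A1 : Rabs v <= B) by (apply Rabs_le; lra).
  assert (A1' : Rabs (- v) <= B) by (apply Rabs_le; lra).
  assert (A3 : Rabs (3 * v) <= B) by (apply Rabs_le; lra).
  assert (A5 : Rabs (5 * v) <= B) by (apply Rabs_le; lra).
  assert (A5' : Rabs (- (5 * v)) <= B) by (apply Rabs_le; lra).
  set (m := sin (3 * v)) in *.
  (* Any initial distance strictly between 0 and [m = sin (3 * v)] would close up as well. *)
  exists (false, true, 3 * v, m / 2).
  apply t_trans with (true, false, - (5 * v), m / 2);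
    [apply t_step, (pocket_flip _ _ _ false true); fold m; lra|].
  apply t_trans with (false, false, v, m / 2 + sin (5 * v));
    [apply t_step, (pocket_same _ _ _ true false); lra|].
  apply t_trans with (true, false, - v, m / 2 + sin (5 * v) - sin v);
    [apply t_step, (pocket_same _ _ _ false false); lra|].
  apply t_trans with (false, false, 5 * v, m / 2 + sin (5 * v));
    [apply t_step, (pocket_same _ _ _ true false); lra|].
  apply t_trans with (true, false, 3 * v, m / 2);
    [apply t_step, (pocket_same _ _ _ false false); lra|].
  apply t_step, (pocket_flip _ _ _ true false); fold m; lra.
Qed.

(** The list of sixteen passages is a palindrome about its first and ninth terms, and the distances
    return in reverse order. It closes for every initial distance [g]; what remains is to choose [g]
    so that all distances are positive. *)
Lemma pocket_orbit_obtuse (x v B : R) :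
  0 < v -> 3 * v < x -> 32 * x <= B -> B <= 1 / 2 -> pocket_orbit x (- v) B.
Proof.
  intros Hv Hx H HB. pose proof PI2_1 as Hpi.
  assert (Bd : forall y, - (5 * x) <= y <= 5 * x -> - (5 * x) <= sin y <= 5 * x).
  { intros y Hy. pose proof (sin_le_abs y). pose proof (Rabs_le y (5 * x) Hy).
    pose proof (Rle_abs (sin y)). pose proof (Rle_abs (- sin y)). rewrite Rabs_Ropp in *. lra. }
  assert (Ab : forall y, - (5 * x) <= y <= 5 * x -> Rabs y <= B) by (intros; apply Rabs_le; lra).
  assert (Cp : forall y, - (5 * x) <= y <= 5 * x -> 0 < cos y) by (intros; apply cos_gt_0; lra).
  assert (Sp : forall y, 0 < y <= 5 * x -> 0 < sin y) by (intros; apply sin_gt_0; lra).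
  set (a := sin x). set (b := sin (x + 2 * v)). set (c := sin (x - 2 * v)).
  set (d := sin (x - 4 * v)). set (e := sin (3 * x - 4 * v)). set (f := sin (3 * x - 2 * v)).
  assert (Ha : 0 < a) by (apply Sp; lra). assert (Hb : 0 < b) by (apply Sp; lra).
  assert (Hc : 0 < c) by (apply Sp; lra). assert (He : 0 < e) by (apply Sp; lra).
  assert (Hf : 0 < f) by (apply Sp; lra). assert (Hs : 0 < sin (2 * v)) by (apply Sp; lra).
  (* Sum-to-product formulas, from which the signs needed for an admissible [g] can be read off. *)
  assert (Hbc : b - c = 2 * cos x * sin (2 * v)).
  { unfold b, c. rewrite sin_plus, sin_minus. ring. }
  assert (Had : a - d = 2 * cos (x - 2 * v) * sin (2 * v)).
  { unfold a, d. replace x with ((x - 2 * v) + 2 * v) at 1 by ring.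
    replace (x - 4 * v) with ((x - 2 * v) - 2 * v) by ring. rewrite sin_plus, (sin_minus (x - 2 * v)). ring. }
  assert (Hed : e + d = 2 * sin (2 * x - 4 * v) * cos x).
  { unfold e, d. replace (3 * x - 4 * v) with ((2 * x - 4 * v) + x) by ring.
    replace (x - 4 * v) with ((2 * x - 4 * v) - x) by ring.
    rewrite sin_plus, (sin_minus (2 * x - 4 * v)). ring. }
  (* Here [3 * v < x] enters in its sharp form [2 * v < 2 * x - 4 * v]; it yields [D4], which leaves
     room for [g] below [a]. *)
  assert (Hlt : sin (2 * v) < sin (2 * x - 4 * v)) by (apply sin_increasing_1; lra).
  assert (C1 := Cp x ltac:(lra)). assert (C2 := Cp (x - 2 * v) ltac:(lra)).
  assert (D1 : 0 < b - c) by nra. assert (D2 : 0 < a - d) by nra.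
  assert (D3 : 0 < e + d) by nra. assert (D4 : b - c < e + d) by nra.
  (* [g] is the distance of the path from the first vertex; the inequalities say
     that the path separates the vertices it passes on different sides. *)
  assert (exists g, 0 < g < a /\ g < a + b - c /\ a + b - c - d - e < g < a + b - c - d) as (g & G).
  { exists ((Rmax 0 (a + b - c - d - e) + Rmin a (Rmin (a + b - c) (a + b - c - d))) / 2).
    unfold Rmax, Rmin. repeat destruct Rle_dec; lra. }
  assert (Ba := Bd x ltac:(lra)). assert (Bb := Bd (x + 2 * v) ltac:(lra)).
  assert (Bc := Bd (x - 2 * v) ltac:(lra)). assert (Bdd := Bd (x - 4 * v) ltac:(lra)).
  assert (Be := Bd (3 * x - 4 * v) ltac:(lra)). assert (Bf := Bd (3 * x - 2 * v) ltac:(lra)).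
  fold a in Ba. fold b in Bb. fold c in Bc. fold d in Bdd. fold e in Be. fold f in Bf.
  assert (Nb : sin (- x - 2 * v) = - b) by (unfold b; rewrite <- sin_neg; f_equal; ring).
  assert (Nf : sin (- (3 * x) + 2 * v) = - f) by (unfold f; rewrite <- sin_neg; f_equal; ring).
  assert (Nc : sin (- x + 2 * v) = - c) by (unfold c; rewrite <- sin_neg; f_equal; ring).
  assert (Na : sin (- x) = - a) by (unfold a; apply sin_neg).
  assert (Nd : sin (- x + 4 * v) = - d) by (unfold d; rewrite <- sin_neg; f_equal; ring).
  exists (false, false, x, g).
  assert (Ea : sin x = a) by reflexivity. assert (Eb : sin (x + 2 * v) = b) by reflexivity.
  assert (Ec : sin (x - 2 * v) = c) by reflexivity. assert (Ed : sin (x - 4 * v) = d) by reflexivity.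
  assert (Ee : sin (3 * x - 4 * v) = e) by reflexivity.
  assert (Ef : sin (3 * x - 2 * v) = f) by reflexivity.
  clearbody a b c d e f.
  apply t_trans with (true, true, - x - 2 * v, a - g);
    [apply t_step; apply (pocket_flip _ _ _ false false); try apply Rabs_le; lra|].
  apply t_trans with (false, true, x - 2 * v, a - g + b);
    [apply t_step; apply (pocket_same _ _ _ true true); try apply Rabs_le; lra|].
  apply t_trans with (true, true, x - 4 * v, a + b - c - g);
    [apply t_step; apply (pocket_same _ _ _ false true); try apply Rabs_le; lra|].
  apply t_trans with (false, true, 3 * x - 4 * v, a + b - c - d - g);
    [apply t_step; apply (pocket_same _ _ _ true true); try apply Rabs_le; lra|].
  set (m := e - (a + b - c - d - g)).
  (* The largest distance is [m + f + c + a]; the last three terms are at most [5 * x] each, so it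
     stays below [32 * x <= B]. *)
  assert (Hm : 0 < m <= 16 * x) by (unfold m; lra).
  assert (Hm' : e - m = a + b - c - d - g) by (unfold m; ring).
  apply t_trans with (true, false, - (3 * x) + 2 * v, m);
    [apply t_step; apply (pocket_flip _ _ _ false true); try apply Rabs_le; lra|].
  apply t_trans with (false, false, - x + 2 * v, m + f);
    [apply t_step; apply (pocket_same _ _ _ true false); try apply Rabs_le; lra|].
  apply t_trans with (true, false, - x, m + f + c);
    [apply t_step; apply (pocket_same _ _ _ false false); try apply Rabs_le; lra|].
  apply t_trans with (false, false, x, m + f + c + a);
    [apply t_step; apply (pocket_same _ _ _ true false); try apply Rabs_le; lra|].
  apply t_trans with (true, false, x - 2 * v, m + f + c);
    [apply t_step; apply (pocket_same _ _ _ false false); try apply Rabs_le; lra|].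
  apply t_trans with (false, false, 3 * x - 2 * v, m + f);
    [apply t_step; apply (pocket_same _ _ _ true false); try apply Rabs_le; lra|].
  apply t_trans with (true, false, 3 * x - 4 * v, m);
    [apply t_step; apply (pocket_same _ _ _ false false); try apply Rabs_le; lra|].
  apply t_trans with (false, true, - x + 4 * v, a + b - c - d - g);
    [apply t_step; apply (pocket_flip _ _ _ true false); try apply Rabs_le; lra|].
  apply t_trans with (true, true, - x + 2 * v, a + b - c - g);
    [apply t_step; apply (pocket_same _ _ _ false true); try apply Rabs_le; lra|].
  apply t_trans with (false, true, x + 2 * v, a - g + b);
    [apply t_step; apply (pocket_same _ _ _ true true); try apply Rabs_le; lra|].
  apply t_trans with (true, true, x, a - g);
    [apply t_step; apply (pocket_same _ _ _ false true); try apply Rabs_le; lra|].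
  apply t_step; apply (pocket_flip _ _ _ true true); try apply Rabs_le; lra.
Qed.

Lemma pocket_orbit_exists (p q B : R) :
  0 < B <= 1 / 2 -> 0 <= p -> (p = 0 -> q = 0) -> - p / 3 <= q ->
  32 * p <= B -> 32 * q <= B -> pocket_orbit p q B.
Proof.
  intros HB Hp H0 Hq Bp Bq.
  destruct (Req_dec p 0) as [E|E].
  { rewrite (H0 E), E. apply pocket_orbit_zero; lra. }
  destruct (Rtotal_order q 0) as [L|[->|L]].
  - destruct (Req_dec p (- 3 * q)) as [E3|E3].
    + replace p with (3 * (- q)) by lra. replace q with (- - q) at 2 by ring.
      apply pocket_orbit_third; lra.
    + replace q with (- - q) by ring. apply pocket_orbit_obtuse; lra.
  - apply pocket_orbit_right; lra.
  - apply pocket_orbit_acute; lra.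
Qed.

(** * Billiard steps in a convex quadrilateral *)

Definition cross (u v : pt) : R := fst u * snd v - snd u * fst v.

(** The sign [o], 1 or -1, stands for the orientation of the vertices, so that both orientations are
    treated alike. *)
Definition left_of (o : R) (P Q x : pt) : Prop := 0 < o * cross (psub Q P) (psub x P).

Definition inside (P Q S T x : pt) : Prop :=
  exists o, (o = 1 \/ o = -1) /\
    left_of o P Q x /\ left_of o Q S x /\ left_of o S T x /\ left_of o T P x.

Definition convex (P Q S T : pt) : Prop :=
  exists o, (o = 1 \/ o = -1) /\
    left_of o P Q S /\ left_of o P Q T /\ left_of o Q S T /\ left_of o Q S P /\
    left_of o S T P /\ left_of o S T Q /\ left_of o T P Q /\ left_of o T P S.

(** Both orders of the endpoints are listed, which makes the relation invariant under rotating and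
    reversing the vertices. *)
Definition side (P Q S T U W : pt) : Prop :=
  (U = P /\ W = Q) \/ (U = Q /\ W = S) \/ (U = S /\ W = T) \/ (U = T /\ W = P) \/
  (U = Q /\ W = P) \/ (U = S /\ W = Q) \/ (U = T /\ W = S) \/ (U = P /\ W = T).

(* A state is a bounce point together with the direction after the bounce. *)
Definition bounce_state := (pt * pt)%type.

Definition bounce (P Q S T : pt) (s s' : bounce_state) : Prop :=
  (forall t, 0 < t < 1 ->
     inside P Q S T (padd (pscale (1 - t) (fst s)) (pscale t (fst s')))) /\
  (exists l, 0 < l /\ fst s' = padd (fst s) (pscale l (snd s))) /\
  exists U W, side P Q S T U W /\ on_open_seg U W (fst s') /\
    snd s' = refl (psub W U) (snd s).

Definition bounces (P Q S T : pt) := clos_trans bounce_state (bounce P Q S T).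

Definition closed_orbit (P Q S T : pt) : Prop := exists s, bounces P Q S T s s.

Lemma clos_trans_mono {A : Type} (R1 R2 : A -> A -> Prop) :
  (forall x y, R1 x y -> R2 x y) ->
  forall x y, clos_trans A R1 x y -> clos_trans A R2 x y.
Proof.
  intros H x y K. induction K; [apply t_step; auto | eapply t_trans; eauto].
Qed.

Lemma clos_trans_map {A B : Type} (f : A -> B) (R1 : A -> A -> Prop) (R2 : B -> B -> Prop) :
  (forall x y, R1 x y -> clos_trans B R2 (f x) (f y)) ->
  forall x y, clos_trans A R1 x y -> clos_trans B R2 (f x) (f y).
Proof.
  intros H x y K. induction K; [auto | eapply t_trans; eauto].
Qed.

Lemma inside_rotate (P Q S T x : pt) : inside P Q S T x -> inside Q S T P x.
Proof. intros (o & Ho & H). exists o. tauto. Qed.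

Lemma inside_reverse (P Q S T x : pt) : inside P Q S T x -> inside Q P T S x.
Proof.
  intros (o & Ho & H1 & H2 & H3 & H4). exists (- o). split; [lra|].
  unfold left_of, cross, psub in *. simpl in *. repeat split; lra.
Qed.

Lemma bounce_rotate (P Q S T : pt) s s' : bounce P Q S T s s' -> bounce Q S T P s s'.
Proof.
  intros (H1 & H2 & U & W & H3 & H4). split; [|split; [exact H2|]].
  - intros t Ht. now apply inside_rotate, H1.
  - exists U, W. split; [unfold side in *; tauto | exact H4].
Qed.

Lemma bounce_reverse (P Q S T : pt) s s' : bounce P Q S T s s' -> bounce Q P T S s s'.
Proof.
  intros (H1 & H2 & U & W & H3 & H4). split; [|split; [exact H2|]].
  - intros t Ht. now apply inside_reverse, H1.
  - exists U, W. split; [unfold side in *; tauto | exact H4].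
Qed.

Lemma closed_orbit_rotate (P Q S T : pt) : closed_orbit P Q S T -> closed_orbit Q S T P.
Proof.
  intros [s H]. exists s. revert H. apply clos_trans_mono, bounce_rotate.
Qed.

Lemma closed_orbit_reverse (P Q S T : pt) : closed_orbit P Q S T -> closed_orbit Q P T S.
Proof.
  intros [s H]. exists s. revert H. apply clos_trans_mono, bounce_reverse.
Qed.

Lemma on_open_seg_sym (P Q x : pt) : on_open_seg P Q x -> on_open_seg Q P x.
Proof.
  intros (t & Ht & ->). exists (1 - t). split; [lra|].
  apply pt_eq; unfold padd, pscale; simpl; ring.
Qed.

Lemma refl_opp (U W v : pt) : refl (psub W U) v = refl (psub U W) v.
Proof.
  assert (D : dot (psub W U) (psub W U) = dot (psub U W) (psub U W))
    by (unfold dot, psub; simpl; ring).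
  unfold refl. rewrite D. apply pt_eq; unfold psub, pscale, dot, Rdiv; simpl; ring.
Qed.

Lemma refl_scale (w v : pt) (l : R) : refl w (pscale l v) = pscale l (refl w v).
Proof.
  apply pt_eq; unfold refl, psub, pscale, dot, Rdiv; simpl; ring.
Qed.

Lemma clos_trans_sequence {A : Type} (R1 : A -> A -> Prop) (x y : A) :
  clos_trans A R1 x y ->
  exists (n : nat) (f : nat -> A), (0 < n)%nat /\ f O = x /\ f n = y /\
    forall k, (k < n)%nat -> R1 (f k) (f (S k)).
Proof.
  induction 1 as [x y H | x y z _ (n & f & N & F0 & Fn & F) _ (m & g & M & G0 & Gm & G)].
  - exists 1%nat, (fun k => match k with O => x | _ => y end).
    repeat split; auto. intros k K. now replace k with O by lia.
  - exists (n + m)%nat, (fun k => if le_lt_dec n k then g (k - n)%nat else f k).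
    repeat split; [lia | | |].
    + destruct le_lt_dec; [lia | auto].
    + destruct le_lt_dec; [|lia]. now replace (n + m - n)%nat with m by lia.
    + intros k K. destruct (le_lt_dec n k), (le_lt_dec n (S k)); try lia.
      * replace (S k - n)%nat with (S (k - n)) by lia. apply G; lia.
      * replace (S k - n)%nat with O by lia. rewrite G0, <- Fn.
        replace n with (S k) by lia. apply F; lia.
      * apply F; lia.
Qed.

(** The sign of the second coordinate decides between the two triangles and the diagonal. In a
    triangle, two of the barycentric coordinates are half-plane inequalities divided by the height
    of the apex. *)
Lemma inside_in_interior (a b c d : R) (x : pt) :
  in_Q a b c d -> inside vA (vB a b) vC (vD c d) x -> in_interior a b c d x.
Proof.
  intros (Ha & Hb & Hc & Hd & Hab & Hcd) (o & Ho & H1 & H2 & H3 & H4).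
  assert (Py : 0 < snd (vB a b)).
  { unfold vB; simpl. apply Rmult_lt_0_compat; [apply Rdiv_lt_0_compat|]; apply sin_gt_0; lra. }
  assert (Ny : snd (vD c d) < 0).
  { unfold vD; simpl. apply Ropp_lt_gt_0_contravar.
    apply Rmult_lt_0_compat; [apply Rdiv_lt_0_compat|]; apply sin_gt_0; lra. }
  unfold in_interior.
  destruct (vB a b) as [bx y], (vD c d) as [dx z], x as [x1 x2].
  unfold left_of, cross, psub, vA, vC in *. simpl in *.
  (* The vertices A, B, C, D run clockwise, so [o = 1] is contradictory. *)
  destruct Ho as [-> | ->]; [nra|].
  destruct (Rtotal_order x2 0) as [L | [-> | L]].
  - right; left. exists (1 - x2 / z - (x1 - x2 / z * dx)), (x1 - x2 / z * dx), (x2 / z).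
    assert (E : x2 = x2 / z * z) by (field; lra). set (t := x2 / z) in *. clearbody t. subst x2.
    assert (K : forall k, 0 < - z * k -> 0 < k) by (intros; nra).
    repeat split; [apply K; lra | apply K; lra | nra | ring |]. unfold padd, pscale; simpl. f_equal; ring.
  - right; right. exists x1. split; [nra|].
    unfold padd, pscale; simpl. f_equal; ring.
  - left. exists (1 - x2 / y - (x1 - x2 / y * bx)), (x2 / y), (x1 - x2 / y * bx).
    assert (E : x2 = x2 / y * y) by (field; lra). set (t := x2 / y) in *. clearbody t. subst x2.
    assert (K : forall k, 0 < y * k -> 0 < k) by (intros; nra).
    repeat split; [apply K; lra | nra | apply K; lra | ring |]. unfold padd, pscale; simpl. f_equal; ring.
Qed.

Lemma periodic_of_closed_orbit (a b c d : R) :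
  in_Q a b c d -> closed_orbit vA (vB a b) vC (vD c d) -> has_periodic_billiard_path a b c d.
Proof.
  intros HQ [s H]. destruct (clos_trans_sequence _ _ _ H) as (n & f & N & F0 & Fn & F).
  set (g := fun k => f (k mod n)).
  assert (G : forall k, bounce vA (vB a b) vC (vD c d) (g k) (g (S k))).
  { intros k. unfold g. assert (K : (k mod n < n)%nat) by (apply Nat.mod_upper_bound; lia).
    assert (E : f (S k mod n) = f (S (k mod n))).
    { destruct (Nat.eq_dec (S (k mod n)) n) as [E|E].
      - rewrite E, Fn, <- F0. f_equal.
        replace (S k) with (S (k mod n) + (k / n) * n)%nat
          by (pose proof (Nat.div_mod_eq k n); lia).
        rewrite Nat.Div0.mod_add, E. apply Nat.Div0.mod_same.
      - f_equal. replace (S k) with (S (k mod n) + (k / n) * n)%nat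
          by (pose proof (Nat.div_mod_eq k n); lia).
        rewrite Nat.Div0.mod_add. apply Nat.mod_small; lia. }
    rewrite E. now apply F. }
  exists (fun k => fst (g k)), n. split; [exact N|]. split; [|split].
  - intros k. unfold g. do 2 f_equal.
    replace (k + n)%nat with (k + 1 * n)%nat by lia. apply Nat.Div0.mod_add.
  - intros k t Ht. apply inside_in_interior; [exact HQ|]. now apply G.
  - intros k. destruct (G k) as (_ & (l & Hl & El) & U & W & HS & Hon & Hr).
    destruct (G (S k)) as (_ & (l' & Hl' & El') & _).
    assert (exists j, (j < 4)%nat /\
      ((U = vert a b c d j /\ W = vert a b c d ((j + 1) mod 4)) \/
       (W = vert a b c d j /\ U = vert a b c d ((j + 1) mod 4)))) as (j & Hj & HUW).
    { destruct HS as [H'|[H'|[H'|[H'|[H'|[H'|[H'|H']]]]]]];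
        [exists 0%nat|exists 1%nat|exists 2%nat|exists 3%nat
        |exists 0%nat|exists 1%nat|exists 2%nat|exists 3%nat]; simpl; split; try lia; tauto. }
    assert (E1 : psub (fst (g (S k))) (fst (g k)) = pscale l (snd (g k))).
    { rewrite El. apply pt_eq; unfold psub, padd, pscale; simpl; ring. }
    assert (E2 : psub (fst (g (S (S k)))) (fst (g (S k))) =
                 pscale (l' / l) (refl (psub W U) (pscale l (snd (g k))))).
    { rewrite El', Hr, refl_scale. generalize (refl (psub W U) (snd (g k))). intros r.
      apply pt_eq; unfold psub, padd, pscale; simpl; field; lra. }
    exists j. split; [exact Hj|]. rewrite E1.
    destruct HUW as [[-> ->] | [-> ->]].
    + split; [exact Hon|]. exists (l' / l). split; [now apply Rdiv_lt_0_compat | exact E2].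
    + split; [now apply on_open_seg_sym|]. exists (l' / l).
      split; [now apply Rdiv_lt_0_compat |]. now rewrite refl_opp.
Qed.

Lemma on_side_left_of (o : R) (P Q S T x : pt) :
  left_of o Q S P -> left_of o S T P -> left_of o S T Q -> left_of o T P Q ->
  on_open_seg P Q x ->
  o * cross (psub Q P) (psub x P) = 0 /\ left_of o Q S x /\ left_of o S T x /\ left_of o T P x.
Proof.
  intros H1 H2 H3 H4 (t & Ht & ->).
  unfold left_of, cross, psub, padd, pscale in *. simpl in *.
  repeat split; [ring | nra..].
Qed.

(** Each of the four side functionals is affine along [X Y], nonnegative at both ends, and zero at
    one end at most, since [X] and [Y] lie on different sides. *)
Lemma inside_between (P Q S T X Y : pt) :
  convex P Q S T ->
  on_open_seg P Q X /\ (on_open_seg Q S Y \/ on_open_seg S T Y \/ on_open_seg T P Y) \/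
  on_open_seg Q S X /\ (on_open_seg P Q Y \/ on_open_seg S T Y \/ on_open_seg T P Y) \/
  on_open_seg S T X /\ (on_open_seg P Q Y \/ on_open_seg Q S Y \/ on_open_seg T P Y) \/
  on_open_seg T P X /\ (on_open_seg P Q Y \/ on_open_seg Q S Y \/ on_open_seg S T Y) ->
  forall t, 0 < t < 1 -> inside P Q S T (padd (pscale (1 - t) X) (pscale t Y)).
Proof.
  intros (o & Ho & H1 & H2 & H3 & H4 & H5 & H6 & H7 & H8) H t Ht.
  assert (L : forall U W, o * cross (psub W U) (psub (padd (pscale (1 - t) X) (pscale t Y)) U) =
     (1 - t) * (o * cross (psub W U) (psub X U)) + t * (o * cross (psub W U) (psub Y U))).
  { intros U W. unfold cross, psub, padd, pscale. simpl. ring. }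
  assert (K1 : forall x, on_open_seg P Q x -> _) by
    (intros x; exact (on_side_left_of o P Q S T x H4 H5 H6 H7)).
  assert (K2 : forall x, on_open_seg Q S x -> _) by
    (intros x; exact (on_side_left_of o Q S T P x H6 H7 H8 H1)).
  assert (K3 : forall x, on_open_seg S T x -> _) by
    (intros x; exact (on_side_left_of o S T P Q x H8 H1 H2 H3)).
  assert (K4 : forall x, on_open_seg T P x -> _) by
    (intros x; exact (on_side_left_of o T P Q S x H2 H3 H4 H5)).
  exists o. split; [exact Ho|]. unfold left_of in *. rewrite !L. clear L H1 H2 H3 H4 H5 H6 H7 H8.
  destruct H as [[HX [HY|[HY|HY]]]|[[HX [HY|[HY|HY]]]|[[HX [HY|[HY|HY]]]|[HX [HY|[HY|HY]]]]]];
    (first [apply K1 in HX | apply K2 in HX | apply K3 in HX | apply K4 in HX]);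
    (first [apply K1 in HY | apply K2 in HY | apply K3 in HY | apply K4 in HY]);
    clear K1 K2 K3 K4; destruct HX as (X1 & X2 & X3 & X4), HY as (Y1 & Y2 & Y3 & Y4);
    repeat split; nra.
Qed.

(** * Unfolding along a segment *)

Definition orthonormal (u w : pt) : Prop := dot u u = 1 /\ dot w w = 1 /\ dot u w = 0.

Definition popp (u : pt) : pt := pscale (-1) u.

(** Direction at angle [theta] from [u] towards [w]. The frame may have either orientation, so
    mirror images need no separate treatment. *)
Definition fr (u w : pt) (theta : R) : pt :=
  padd (pscale (cos theta) u) (pscale (sin theta) w).

Definition ray (O u w : pt) (t theta : R) : pt := padd O (pscale t (fr u w theta)).

Lemma popp_popp (u : pt) : popp (popp u) = u.
Proof. apply pt_eq; unfold popp, pscale; simpl; ring. Qed.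

Lemma orthonormal_oppl (u w : pt) : orthonormal u w -> orthonormal (popp u) w.
Proof. unfold orthonormal, popp, dot, pscale; simpl; lra. Qed.

Lemma orthonormal_oppr (u w : pt) : orthonormal u w -> orthonormal u (popp w).
Proof. unfold orthonormal, popp, dot, pscale; simpl; lra. Qed.

Lemma fr_oppr (u w : pt) (x : R) : fr u (popp w) x = fr u w (- x).
Proof. unfold fr. rewrite cos_neg, sin_neg. apply pt_eq; unfold popp, padd, pscale; simpl; ring. Qed.

Lemma fr_oppl (u w : pt) (x : R) : fr (popp u) w x = fr u w (PI - x).
Proof.
  unfold fr. rewrite Rtrigo_facts.cos_pi_minus, Rtrigo_facts.sin_pi_minus.
  apply pt_eq; unfold popp, padd, pscale; simpl; ring.
Qed.

Lemma fr_add_PI (u w : pt) (x : R) : fr u w (x + PI) = popp (fr u w x).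
Proof.
  unfold fr. rewrite neg_cos, neg_sin. apply pt_eq; unfold popp, padd, pscale; simpl; ring.
Qed.

Lemma refl_fr (u w : pt) (l x y : R) :
  orthonormal u w -> l <> 0 -> refl (pscale l (fr u w x)) (fr u w y) = fr u w (2 * x - y).
Proof.
  intros (Hu & Hw & Huw) Hl.
  assert (D1 : dot (fr u w y) (pscale l (fr u w x)) = l * cos (y - x)).
  { rewrite cos_minus. transitivity (l * (cos y * cos x * dot u u + sin y * sin x * dot w w
      + (cos y * sin x + sin y * cos x) * dot u w));
    [unfold dot, fr, padd, pscale; simpl; ring | rewrite Hu, Hw, Huw; ring]. }
  assert (D2 : dot (pscale l (fr u w x)) (pscale l (fr u w x)) = l * l).
  { transitivity (l * l * ((sin x)² * dot w w + (cos x)² * dot u u + 2 * cos x * sin x * dot u w));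
    [unfold dot, fr, padd, pscale, Rsqr; simpl; ring |].
    rewrite Hu, Hw, Huw. rewrite !Rmult_1_r, Rmult_0_r, Rplus_0_r, sin2_cos2. ring. }
  unfold refl. rewrite D1, D2.
  assert (C : cos (2 * x - y) = 2 * cos (y - x) * cos x - cos y).
  { replace (2 * x - y) with (x - (y - x)) by ring. replace y with ((y - x) + x) at 3 by ring.
    rewrite cos_minus, (cos_plus (y - x)). ring. }
  assert (S : sin (2 * x - y) = 2 * cos (y - x) * sin x - sin y).
  { replace (2 * x - y) with (x - (y - x)) by ring. replace y with ((y - x) + x) at 3 by ring.
    rewrite sin_minus, (sin_plus (y - x)). ring. }
  unfold fr. rewrite C, S. apply pt_eq; unfold psub, padd, pscale; simpl; field; exact Hl.
Qed.

Lemma ray_on_open_seg (O u w : pt) (t l x : R) :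
  0 < t < l -> on_open_seg O (ray O u w l x) (ray O u w t x).
Proof.
  intros H. exists (t / l). split.
  - split; [apply Rdiv_lt_0_compat; lra|]. apply Rmult_lt_reg_r with l; [lra|].
    replace (t / l * l) with t by (field; lra). lra.
  - apply pt_eq; unfold ray, padd, pscale; simpl; field; lra.
Qed.

Lemma psub_ray (O u w : pt) (l x : R) : psub (ray O u w l x) O = pscale l (fr u w x).
Proof. apply pt_eq; unfold ray, psub, padd, pscale; simpl; ring. Qed.

(* The equation says that the flight has the same angular momentum about both
   endpoints of the segment. *)
Lemma flight (O O' u w : pt) (L t x t' x' y : R) :
  O' = padd O (pscale L u) ->
  t * sin (y - x) = L * sin y + t' * sin (x' - y) -> 0 < cos y ->
  t * cos x + t' * cos x' < L ->
  exists l, 0 < l /\ ray O' u w (- t') x' = padd (ray O u w t x) (pscale l (fr u w y)).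
Proof.
  intros -> H C HL. exists ((L - t * cos x - t' * cos x') / cos y).
  split; [apply Rdiv_lt_0_compat; lra|].
  rewrite !sin_minus in H.
  assert (E : - t' * sin x' = t * sin x + (L - t * cos x - t' * cos x') / cos y * sin y).
  { apply Rmult_eq_reg_r with (cos y); [|lra].
    replace ((t * sin x + (L - t * cos x - t' * cos x') / cos y * sin y) * cos y)
      with (t * sin x * cos y + (L - t * cos x - t' * cos x') * sin y) by (field; lra). lra. }
  assert (E' : L - t' * cos x' = t * cos x + (L - t * cos x - t' * cos x') / cos y * cos y)
    by (field; lra).
  unfold ray, fr.
  apply pt_eq; unfold padd, pscale; simpl.
  - transitivity (fst O + (L - t' * cos x') * fst u + (- t' * sin x') * fst w); [ring|].
    rewrite E, E'. ring.
  - transitivity (snd O + (L - t' * cos x') * snd u + (- t' * sin x') * snd w); [ring|].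
    rewrite E, E'. ring.
Qed.

Lemma Rabs_bounds (x y : R) : Rabs x <= y -> - y <= x <= y.
Proof. unfold Rabs. destruct Rcase_abs; lra. Qed.

Lemma div_pos_le (K c x y : R) : 0 < K -> 0 < c -> c <= x -> K <= c * y -> 0 < K / x <= y.
Proof.
  intros HK Hc Hx Hy. assert (E : K / x * x = K) by (field; lra).
  assert (0 < K / x) by (apply Rdiv_lt_0_compat; lra). split; [auto|]. nra.
Qed.

(** * Pocket steps along a side *)

(** The bounce point lies on the other side at [O], whose deficit is [e]. Its distance [t] from [O]
    solves [t * cos (A - e) = L * M]: the line of direction [- A] passes [O] at distance [L * M]. *)
Definition side_state (O u w : pt) (L e A M : R) : bounce_state :=
  (ray O u w (L * M / cos (A - e)) (PI / 2 - e), fr u w (- A)).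

(** A single bounce, off [O' Z']. The equation of [flight] becomes [M' = M - sin A]. In the frame
    turned towards [O] the incoming angle is [PI + A], and reflection in the side of angle
    [PI / 2 - e'] makes it [- (A + 2 * e')]. *)
Lemma side_state_same (O O' Z Z' u w : pt) (L l l' m B e e' A M A' M' : R) :
  convex O O' Z' Z -> orthonormal u w ->
  O' = padd O (pscale L u) -> Z = ray O u w l (PI / 2 - e) ->
  Z' = ray O' (popp u) w l' (PI / 2 - e') ->
  m <= L <= 4 -> m <= l -> m <= l' -> 8 * B < m -> B <= 1 / 16 ->
  Rabs e <= B -> Rabs e' <= B ->
  A' = A + 2 * e' -> M' = M - sin A ->
  0 < M <= B -> 0 < M' <= B -> Rabs A <= B -> Rabs A' <= B ->
  bounces O O' Z' Z (side_state O u w L e A M) (side_state O' (popp u) w L e' A' M').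
Proof.
  intros HC HO EO EZ EZ' HL Hl Hl' HB HB' He He' EA EM HM HM' HA HA'.
  apply Rabs_bounds in He, He', HA, HA'.
  assert (C1 : / 2 <= cos (A - e)) by (apply cos_ge_half, Rabs_le; lra).
  assert (C2 : / 2 <= cos (A' - e')) by (apply cos_ge_half, Rabs_le; lra).
  assert (C3 : / 2 <= cos (- A)) by (apply cos_ge_half, Rabs_le; lra).
  (* With [L <= 4] these distances are at most [8 * B < m], so the bounce points lie inside the
     sides. *)
  assert (T1 : 0 < L * M / cos (A - e) <= 2 * L * B) by (apply (div_pos_le _ (/ 2)); nra).
  assert (T2 : 0 < L * M' / cos (A' - e') <= 2 * L * B) by (apply (div_pos_le _ (/ 2)); nra).
  set (t := L * M / cos (A - e)) in *. set (t' := L * M' / cos (A' - e')) in *.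
  assert (E1 : t * cos (A - e) = L * M) by (unfold t; field; lra).
  assert (E2 : t' * cos (A' - e') = L * M') by (unfold t'; field; lra).
  destruct (flight O O' u w L t (PI / 2 - e) t' (- (PI / 2 - e')) (- A)) as (d & Hd & Ed).
  - exact EO.
  - replace (- A - (PI / 2 - e)) with (- (PI / 2 + (A - e))) by ring.
    replace (- (PI / 2 - e') - - A) with (- (PI / 2 - (A' - e'))) by (rewrite EA; ring).
    rewrite !sin_neg, <- cos_sin, sin_shift. rewrite EM in E2. lra.
  - lra.
  - pose proof (COS_bound (PI / 2 - e)). pose proof (COS_bound (- (PI / 2 - e'))). nra.
  - assert (EX : ray O' (popp u) w t' (PI / 2 - e') = ray O' u w (- t') (- (PI / 2 - e'))).
    { unfold ray. rewrite fr_oppl.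
      replace (PI - (PI / 2 - e')) with (- (PI / 2 - e') + PI) by ring. rewrite fr_add_PI.
      apply pt_eq; unfold padd, popp, pscale; simpl; ring. }
    apply t_step. unfold side_state. fold t t'. split; [|split]; simpl.
    + apply inside_between; [exact HC|]. right; right; right. split.
      * apply on_open_seg_sym. rewrite EZ. apply ray_on_open_seg. nra.
      * right; left. rewrite EZ'. apply ray_on_open_seg. nra.
    + exists d. split; [exact Hd|]. rewrite EX. exact Ed.
    + exists O', Z'. split; [unfold side; tauto|]. split.
      * rewrite EZ'. apply ray_on_open_seg. nra.
      * rewrite EZ', psub_ray.
        replace (fr u w (- A)) with (fr (popp u) w (PI + A)) by (rewrite fr_oppl; f_equal; ring).
        rewrite refl_fr; [|now apply orthonormal_oppl | nra].
        f_equal. rewrite EA. field.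
Qed.

(** [y] is the abscissa where the path meets the segment and [t * sin e] that of the bounce point;
    the difference is [K * cos A * cos e / (sin A * cos (A - e))]. *)
Lemma crossing_room (K y t A e : R) :
  0 < K -> 0 < sin A -> 0 < cos A -> 0 < cos e -> 0 < cos (A - e) ->
  y * sin A = K -> t * cos (A - e) = K -> t * sin e < y.
Proof.
  intros HK HS HCA HCe HC Ey Et.
  assert (P : 0 < sin A * cos (A - e) * (y - t * sin e)).
  { replace (sin A * cos (A - e) * (y - t * sin e))
      with (cos (A - e) * (y * sin A) - (t * cos (A - e)) * (sin A * sin e)) by ring.
    rewrite Ey, Et, cos_minus.
    replace (_ - _) with (K * (cos A * cos e)) by ring.
    repeat apply Rmult_lt_0_compat; lra. }
  assert (0 < sin A * cos (A - e)) by now apply Rmult_lt_0_compat. nra.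
Qed.

(** Instead of crossing the segment, which is a side here, the path is reflected in it at distance
    [y] from [O]. This gives two bounces, first off [O O'] and then off [O' Z']. *)
Lemma side_state_flip (O O' Z Z' u w : pt) (L l l' m B e e' A M A' M' : R) :
  convex O O' Z' Z -> orthonormal u w ->
  O' = padd O (pscale L u) -> Z = ray O u w l (PI / 2 - e) ->
  Z' = ray O' (popp u) w l' (PI / 2 - e') ->
  m <= L <= 4 -> m <= l -> m <= l' -> 8 * B < m -> B <= 1 / 16 ->
  Rabs e <= B -> Rabs e' <= B ->
  A' = - A + 2 * e' -> M' = sin A - M ->
  0 < M <= B -> 0 < M' <= B -> Rabs A <= B -> Rabs A' <= B ->
  bounces O O' Z' Z (side_state O u w L e A M) (side_state O' (popp u) w L e' A' M').
Proof.
  intros HC HO EO EZ EZ' HL Hl Hl' HB HB' He He' EA EM HM HM' HA HA'.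
  apply Rabs_bounds in He, He', HA, HA'.
  assert (C1 : / 2 <= cos (A - e)) by (apply cos_ge_half, Rabs_le; lra).
  assert (C2 : / 2 <= cos (A' - e')) by (apply cos_ge_half, Rabs_le; lra).
  assert (C3 : / 2 <= cos A) by (apply cos_ge_half, Rabs_le; lra).
  assert (C4 : / 2 <= cos e) by (apply cos_ge_half, Rabs_le; lra).
  assert (C5 : / 2 <= cos e') by (apply cos_ge_half, Rabs_le; lra).
  assert (C6 : cos (A' - e') = cos (A - e')) by (rewrite <- cos_neg; f_equal; rewrite EA; ring).
  assert (C7 : cos (- A) = cos A) by apply cos_neg.
  assert (T1 : 0 < L * M / cos (A - e) <= 2 * L * B) by (apply (div_pos_le _ (/ 2)); nra).
  assert (T2 : 0 < L * M' / cos (A' - e') <= 2 * L * B) by (apply (div_pos_le _ (/ 2)); nra).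
  assert (Ha : 0 < sin A) by lra.
  assert (Ey : L * M / sin A * sin A = L * M) by (field; lra).
  set (t := L * M / cos (A - e)) in *. set (t' := L * M' / cos (A' - e')) in *.
  set (y := L * M / sin A) in *.
  assert (E1 : t * cos (A - e) = L * M) by (unfold t; field; lra).
  assert (E2 : t' * cos (A' - e') = L * M') by (unfold t'; field; lra).
  assert (Ey' : (L - y) * sin A = L * M') by (rewrite EM; lra).
  assert (Hy : 0 < y < L) by (split; nra).
  assert (R1 : t * sin e < y) by (apply (crossing_room (L * M) y t A e); nra).
  assert (R2 : t' * sin e' < L - y).
  { rewrite C6 in E2, C2. apply (crossing_room (L * M') (L - y) t' A e'); nra. }
  assert (EY : ray O' u w (- (L - y)) 0 = ray O u w y 0).
  { rewrite EO. unfold ray, fr. rewrite cos_0, sin_0.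
    apply pt_eq; unfold padd, pscale; simpl; ring. }
  assert (EQ : O' = ray O u w L 0).
  { rewrite EO. unfold ray, fr. rewrite cos_0, sin_0.
    apply pt_eq; unfold padd, pscale; simpl; ring. }
  assert (OY : on_open_seg O O' (ray O u w y 0)) by (rewrite EQ; now apply ray_on_open_seg).
  apply t_trans with (ray O u w y 0, fr u w A); apply t_step.
  - destruct (flight O O' u w L t (PI / 2 - e) (L - y) 0 (- A)) as (d & Hd & Ed).
    + exact EO.
    + replace (- A - (PI / 2 - e)) with (- (PI / 2 + (A - e))) by ring.
      replace (0 - - A) with A by ring. rewrite !sin_neg, <- cos_sin. lra.
    + lra.
    + rewrite cos_shift, cos_0. lra.
    + unfold side_state. fold t. split; [|split]; simpl.
      * apply inside_between; [exact HC|]. right; right; right. split.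
        -- apply on_open_seg_sym. rewrite EZ. apply ray_on_open_seg. nra.
        -- left. exact OY.
      * exists d. split; [exact Hd|]. now rewrite <- EY.
      * exists O, O'. split; [unfold side; tauto|]. split; [exact OY|].
        rewrite EQ, psub_ray, refl_fr; [|exact HO|nra]. f_equal. ring.
  - destruct (flight O O' u w L y 0 t' (- (PI / 2 - e')) A) as (d & Hd & Ed).
    + exact EO.
    + replace (- (PI / 2 - e') - A) with (- (PI / 2 + (A - e'))) by ring.
      rewrite sin_neg, <- cos_sin, <- C6, Rminus_0_r. lra.
    + lra.
    + rewrite cos_neg, cos_shift, cos_0. lra.
    + assert (EX : ray O' (popp u) w t' (PI / 2 - e') = ray O' u w (- t') (- (PI / 2 - e'))).
      { unfold ray. rewrite fr_oppl.
        replace (PI - (PI / 2 - e')) with (- (PI / 2 - e') + PI) by ring. rewrite fr_add_PI.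
        apply pt_eq; unfold padd, popp, pscale; simpl; ring. }
      unfold side_state. fold t'. split; [|split]; simpl.
      * apply inside_between; [exact HC|]. left. split; [exact OY|].
        left. rewrite EZ'. apply ray_on_open_seg. nra.
      * exists d. split; [exact Hd|]. rewrite EX. exact Ed.
      * exists O', Z'. split; [unfold side; tauto|]. split.
        -- rewrite EZ'. apply ray_on_open_seg. nra.
        -- rewrite EZ', psub_ray.
           replace (fr u w A) with (fr (popp u) w (PI - A)) by (rewrite fr_oppl; f_equal; ring).
           rewrite refl_fr; [|now apply orthonormal_oppl | nra].
           f_equal. rewrite EA. field.
Qed.

Lemma convex_reverse (P Q S T : pt) : convex P Q S T -> convex Q P T S.
Proof.
  intros (o & Ho & H). exists (- o). split; [lra|].
  unfold left_of, cross, psub in *. simpl in *. repeat split; lra.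
Qed.

(** The two sides of the slit are folded onto each other, so [f] forgets [s]. Steps from the second
    endpoint are those from the first in the reversed quadrilateral. *)
Lemma closed_orbit_side (P Q S T u w : pt) (L l l' m B p q : R) :
  convex P Q S T -> orthonormal u w ->
  Q = padd P (pscale L u) -> T = ray P u w l (PI / 2 - p) ->
  S = ray Q (popp u) w l' (PI / 2 - q) ->
  m <= L <= 4 -> m <= l -> m <= l' -> 8 * B < m -> B <= 1 / 16 ->
  Rabs p <= B -> Rabs q <= B ->
  pocket_orbit p q B -> closed_orbit P Q S T.
Proof.
  intros HC HO EQ ET ES HL Hl Hl' HB HB' Hp Hq [x Hx].
  set (f := fun x : pocket_state => match x with
    | (b, _, A, M) => if b then side_state Q (popp u) w L q A M else side_state P u w L p A M
    end).
  exists (f x). revert Hx. apply clos_trans_map.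
  assert (EP : P = padd Q (pscale L (popp u))).
  { rewrite EQ. apply pt_eq; unfold padd, popp, pscale; simpl; ring. }
  intros _ _ [[] s A M A' M' EA EM HM HM' HA HA' | [] s A M A' M' EA EM HM HM' HA HA']; simpl.
  - apply clos_trans_mono with (bounce Q P T S); [intros; now apply bounce_reverse|].
    pattern u at 2; rewrite <- (popp_popp u).
    eapply (side_state_same Q P S T (popp u) w L l' l m B q p A M);
      eauto using convex_reverse, orthonormal_oppl.
    rewrite popp_popp; exact ET.
  - eapply (side_state_same P Q T S u w L l l' m B p q A M); eauto.
  - apply clos_trans_mono with (bounce Q P T S); [intros; now apply bounce_reverse|].
    pattern u at 2; rewrite <- (popp_popp u).
    eapply (side_state_flip Q P S T (popp u) w L l' l m B q p A M);
      eauto using convex_reverse, orthonormal_oppl.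
    rewrite popp_popp; exact ET.
  - eapply (side_state_flip P Q T S u w L l l' m B p q A M); eauto.
Qed.

(** * Pocket steps along a diagonal *)

(** The state after the second of the two bounces near [O], on the side at angle [- gamma]. Its
    distance [t] from [O] solves [t * sin (A + gamma) = L * M]. *)
Definition diag_state (O u w : pt) (L gamma A M : R) : bounce_state :=
  (ray O u w (L * M / sin (A + gamma)) (- gamma), fr u w A).

(** Law of sines in the triangle of [O] and the two bounce points, with angle [PI / 2 - e] at [O]
    and [x] at the first bounce; reflection preserves the distance [K] from [O] to the line of the
    path. *)
Lemma around_vertex (O u w : pt) (K x g1 g2 e : R) :
  g1 + g2 = PI / 2 - e -> 0 < K -> 0 < sin x -> 0 < cos (x - e) -> 0 < cos e ->
  exists l, 0 < l /\ ray O u w (K / cos (x - e)) (- g2) =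
    padd (ray O u w (K / sin x) g1) (pscale l (fr u w (PI + (x + g1)))).
Proof.
  intros E HK HS HC He.
  exists (K * cos e / (sin x * cos (x - e))). split.
  { apply Rdiv_lt_0_compat; apply Rmult_lt_0_compat; lra. }
  replace g2 with (PI / 2 - (e + g1)) by lra.
  assert (C : K / cos (x - e) * sin (e + g1) =
    K / sin x * cos g1 + K * cos e / (sin x * cos (x - e)) * - cos (x + g1)).
  { apply Rmult_eq_reg_r with (sin x * cos (x - e)); [|apply Rgt_not_eq; now apply Rmult_lt_0_compat].
    transitivity (K * (sin (e + g1) * sin x)); [field; lra|].
    transitivity (K * (cos g1 * cos (x - e) - cos e * cos (x + g1))); [|field; lra].
    rewrite sin_plus, cos_minus, cos_plus. ring. }
  assert (S : K / cos (x - e) * - cos (e + g1) =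
    K / sin x * sin g1 + K * cos e / (sin x * cos (x - e)) * - sin (x + g1)).
  { apply Rmult_eq_reg_r with (sin x * cos (x - e)); [|apply Rgt_not_eq; now apply Rmult_lt_0_compat].
    transitivity (K * (- cos (e + g1) * sin x)); [field; lra|].
    transitivity (K * (sin g1 * cos (x - e) - cos e * sin (x + g1))); [|field; lra].
    rewrite sin_plus, cos_minus, cos_plus. ring. }
  unfold ray. rewrite (Rplus_comm PI), fr_add_PI. unfold fr.
  rewrite cos_neg, sin_neg, cos_shift, sin_shift.
  apply pt_eq; unfold padd, popp, pscale; simpl.
  - transitivity (fst O + (K / cos (x - e) * sin (e + g1)) * fst u
      + (K / cos (x - e) * - cos (e + g1)) * fst w); [ring|]. rewrite C, S. ring.
  - transitivity (snd O + (K / cos (x - e) * sin (e + g1)) * snd u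
      + (K / cos (x - e) * - cos (e + g1)) * snd w); [ring|]. rewrite C, S. ring.
Qed.

Lemma sin_perturb (k g y : R) : k <= sin g -> Rabs y <= k / 2 -> k / 2 <= sin (g + y).
Proof.
  intros H Hy. pose proof (sin_lipschitz (g + y) g) as K.
  replace (g + y - g) with y in K by ring.
  apply (Rle_trans _ _ _ K), Rabs_bounds in Hy. lra.
Qed.

Lemma cos_perturb (k g y : R) : k <= cos g -> Rabs y <= k / 2 -> k / 2 <= cos (g + y).
Proof.
  intros H Hy. pose proof (cos_lipschitz (g + y) g) as K.
  replace (g + y - g) with y in K by ring.
  apply (Rle_trans _ _ _ K), Rabs_bounds in Hy. lra.
Qed.

(* At an end of a diagonal the path bounces off both sides, with angles [g1] and
   [g2] to the diagonal, so that the direction is turned by twice the interior angle. *)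
Lemma diag_turn (P Q S T O Z1 Z2 u w X : pt) (L l1 l2 m k B g1 g2 e A M : R) :
  orthonormal u w -> Z1 = ray O u w l1 g1 -> Z2 = ray O u w l2 (- g2) ->
  side P Q S T O Z1 -> side P Q S T O Z2 ->
  (forall Y, on_open_seg O Z1 Y ->
     forall t, 0 < t < 1 -> inside P Q S T (padd (pscale (1 - t) X) (pscale t Y))) ->
  (forall Y Y', on_open_seg O Z1 Y -> on_open_seg O Z2 Y' ->
     forall t, 0 < t < 1 -> inside P Q S T (padd (pscale (1 - t) Y) (pscale t Y'))) ->
  g1 + g2 = PI / 2 - e -> k <= sin g1 -> k <= cos g1 ->
  0 < L <= 4 -> m <= l1 -> m <= l2 -> 4 * B <= k -> 8 * B < k * m -> B <= 1 / 16 ->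
  0 < M <= B -> Rabs A <= B -> Rabs e <= B ->
  (exists l, 0 < l /\
     ray O u w (L * M / sin (g1 - A)) g1 = padd X (pscale l (fr u w (PI + A)))) ->
  bounces P Q S T (X, fr u w (PI + A)) (diag_state O u w L g2 (A + 2 * e) M).
Proof.
  intros HO E1 E2 HS1 HS2 I1 I2 Eg Hs Hc HL Hl1 Hl2 HB HBm HB' HM HA He (d & Hd & Ed).
  apply Rabs_bounds in HA, He.
  assert (S1 : k / 2 <= sin (g1 - A)) by (apply sin_perturb; [lra|apply Rabs_le; lra]).
  assert (S2 : k / 2 <= cos (g1 - A - e)).
  { replace (g1 - A - e) with (g1 + (- A - e)) by ring.
    apply cos_perturb; [lra|apply Rabs_le; lra]. }
  assert (He' : / 2 <= cos e) by (apply cos_ge_half, Rabs_le; lra).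
  assert (S3 : sin (A + 2 * e + g2) = cos (g1 - A - e)).
  { rewrite <- sin_shift. f_equal. lra. }
  assert (Hk : 0 < k / 2) by lra.
  assert (HLM : 0 < L * M) by (apply Rmult_lt_0_compat; lra).
  assert (HLB : L * M <= 4 * B) by (apply Rmult_le_compat; lra).
  assert (T1 : 0 < L * M / sin (g1 - A) <= 8 * B / k).
  { apply (div_pos_le _ (k / 2)); try lra. replace (k / 2 * (8 * B / k)) with (4 * B) by (field; lra). lra. }
  assert (T2 : 0 < L * M / cos (g1 - A - e) <= 8 * B / k).
  { apply (div_pos_le _ (k / 2)); try lra. replace (k / 2 * (8 * B / k)) with (4 * B) by (field; lra). lra. }
  assert (T3 : 8 * B / k < m).
  { apply Rmult_lt_reg_r with k; [lra|]. replace (8 * B / k * k) with (8 * B) by (field; lra). lra. }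
  destruct (around_vertex O u w (L * M) (g1 - A) g1 g2 e Eg HLM) as (d' & Hd' & Ed'); try lra.
  assert (O1 : on_open_seg O Z1 (ray O u w (L * M / sin (g1 - A)) g1))
    by (rewrite E1; apply ray_on_open_seg; lra).
  assert (O2 : on_open_seg O Z2 (ray O u w (L * M / cos (g1 - A - e)) (- g2)))
    by (rewrite E2; apply ray_on_open_seg; lra).
  assert (Ef : fr u w (PI + (g1 - A + g1)) = fr u w (2 * g1 - (PI + A))).
  { replace (PI + (g1 - A + g1)) with (2 * g1 - (PI + A) + PI + PI) by ring.
    rewrite !fr_add_PI. apply popp_popp. }
  rewrite Ef in Ed'.
  apply t_trans with (ray O u w (L * M / sin (g1 - A)) g1, fr u w (2 * g1 - (PI + A)));
    apply t_step.
  - split; [|split]; simpl.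
    + now apply I1.
    + now exists d.
    + exists O, Z1. split; [exact HS1|]. split; [exact O1|].
      rewrite E1, psub_ray, refl_fr; [reflexivity|exact HO|lra].
  - unfold diag_state. rewrite S3. split; [|split]; simpl.
    + now apply I2.
    + exists d'. auto.
    + exists O, Z2. split; [exact HS2|]. split; [exact O2|].
      rewrite E2, psub_ray, refl_fr; [|exact HO|lra].
      replace (2 * - g2 - (2 * g1 - (PI + A))) with (A + 2 * e) by lra. reflexivity.
Qed.

(** The angles from the diagonal [P S] are [al] to [P T] and [de] to [P Q] at [P], and [al'] to
    [S Q] and [de'] to [S T] at [S]. The frame at [S] is the one at [P] after a half turn. [m]
    bounds the sides from below, [k] the sines and cosines. *)
Definition diag_quad (P Q S T u w : pt) (L al de al' de' p q m k : R) : Prop :=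
  convex P Q S T /\ orthonormal u w /\ S = padd P (pscale L u) /\
  (exists l, m <= l /\ Q = ray P u w l (- de)) /\
  (exists l, m <= l /\ T = ray P u w l al) /\
  (exists l, m <= l /\ Q = ray S (popp u) (popp w) l al') /\
  (exists l, m <= l /\ T = ray S (popp u) (popp w) l (- de')) /\
  al + de = PI / 2 - p /\ al' + de' = PI / 2 - q /\
  (k <= sin al /\ k <= cos al) /\ (k <= sin de /\ k <= cos de) /\
  (k <= sin al' /\ k <= cos al') /\ (k <= sin de' /\ k <= cos de').

Lemma convex_rotate (P Q S T : pt) : convex P Q S T -> convex Q S T P.
Proof. intros (o & Ho & H). exists o. tauto. Qed.

Lemma ray_opp_r (O u w : pt) (t x : R) : ray O u (popp w) t x = ray O u w t (- x).
Proof. unfold ray. now rewrite fr_oppr. Qed.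

Lemma diag_quad_swap (P Q S T u w : pt) (L al de al' de' p q m k : R) :
  diag_quad P Q S T u w L al de al' de' p q m k ->
  diag_quad S T P Q (popp u) (popp w) L al' de' al de q p m k.
Proof.
  intros (HC & HO & ES & H1 & H2 & H3 & H4 & H). unfold diag_quad. rewrite !popp_popp.
  split; [now do 2 apply convex_rotate|].
  split; [now apply orthonormal_oppl, orthonormal_oppr|].
  split; [rewrite ES; apply pt_eq; unfold padd, popp, pscale; simpl; ring|]. tauto.
Qed.

Lemma diag_quad_mirror (P Q S T u w : pt) (L al de al' de' p q m k : R) :
  diag_quad P Q S T u w L al de al' de' p q m k ->
  diag_quad P T S Q u (popp w) L de al de' al' p q m k.
Proof.
  intros (HC & HO & ES & (l1 & H1) & (l2 & H2) & (l3 & H3) & (l4 & H4) & H).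
  unfold diag_quad. rewrite !popp_popp.
  split; [now apply convex_rotate, convex_reverse|].
  split; [now apply orthonormal_oppr|]. split; [exact ES|].
  split; [exists l2; now rewrite ray_opp_r, Ropp_involutive|].
  split; [exists l1; now rewrite ray_opp_r|].
  rewrite ray_opp_r in H3. rewrite ray_opp_r, Ropp_involutive in H4.
  split; [now exists l4|]. split; [now exists l3|].
  rewrite (Rplus_comm de), (Rplus_comm de'). tauto.
Qed.

(** Two such distances, one at each end, add up to less than [m / 2 <= L], which leaves a positive
    flight length along the diagonal. *)
Lemma diag_flight_room (L M s k B m : R) :
  m / 2 <= L <= 4 -> 0 < M <= B -> 0 < k -> 32 * B < k * m -> k / 2 <= s ->
  0 < L * M / s < m / 4.
Proof.
  intros HL HM Hk HB Hs. assert (Hm : 0 < m) by (apply Rmult_lt_reg_l with k; lra).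
  assert (HLM : 0 < L * M) by (apply Rmult_lt_0_compat; lra).
  assert (HLB : L * M <= 4 * B) by (apply Rmult_le_compat; lra).
  assert (T : 0 < L * M / s <= 8 * B / k).
  { apply (div_pos_le _ (k / 2)); try lra. replace (k / 2 * (8 * B / k)) with (4 * B) by (field; lra). lra. }
  assert (8 * B / k < m / 4).
  { apply Rmult_lt_reg_r with k; [lra|]. replace (8 * B / k * k) with (8 * B) by (field; lra). lra. }
  lra.
Qed.

(** The path arrives at [S] on the side of [Q], so it bounces off [S Q] first and off [S T]
    second. *)
Lemma diag_state_same (P Q S T u w : pt) (L al de al' de' p q m k B A M A' M' : R) :
  diag_quad P Q S T u w L al de al' de' p q m k ->
  m / 2 <= L <= 4 -> 4 * B <= k -> 32 * B < k * m -> B <= 1 / 16 ->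
  Rabs p <= B -> Rabs q <= B ->
  A' = A + 2 * q -> M' = M - sin A ->
  0 < M <= B -> 0 < M' <= B -> Rabs A <= B ->
  bounces P Q S T (diag_state P u w L de A M) (diag_state S (popp u) (popp w) L de' A' M').
Proof.
  intros (HC & HO & ES & (l1 & Hl1 & EQ) & (l2 & Hl2 & ET) & (l3 & Hl3 & EQ') & (l4 & Hl4 & ET')
    & Hp & Hq & (Ka & Ka') & (Kd & Kd') & (Kb & Kb') & (Kc & Kc'))
    HL HB HBm HB' Bp Bq EA EM HM HM' HA.
  assert (HA2 : Rabs A <= k / 2) by lra.
  assert (HA3 : Rabs (- A) <= k / 2) by (now rewrite Rabs_Ropp).
  assert (S1 := sin_perturb k de A Kd HA2). assert (S2 := sin_perturb k al' (- A) Kb HA3).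
  rewrite Rplus_comm in S1.
  assert (C3 : / 2 <= cos A) by (apply cos_ge_half; lra).
  assert (T1 := diag_flight_room L M _ k B m HL HM ltac:(lra) HBm S1).
  assert (T2 := diag_flight_room L M' _ k B m HL HM' ltac:(lra) HBm S2).
  assert (E1 : L * M / sin (A + de) * sin (A + de) = L * M) by (field; lra).
  assert (E2 : L * M' / sin (al' + - A) * sin (al' + - A) = L * M') by (field; lra).
  assert (E3 : L * M' = L * M - L * sin A) by (rewrite EM; ring).
  set (X := ray P u w (L * M / sin (A + de)) (- de)).
  assert (OX : on_open_seg P Q X) by (rewrite EQ; apply ray_on_open_seg; lra).
  assert (Ef : fr u w A = fr (popp u) (popp w) (PI + A)).
  { rewrite fr_oppr, fr_oppl. replace (PI - - (PI + A)) with (A + PI + PI) by ring.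
    now rewrite !fr_add_PI, popp_popp. }
  unfold diag_state at 1. fold X. rewrite EA, Ef.
  apply (diag_turn P Q S T S Q T (popp u) (popp w) X L l3 l4 m k B al' de' q A M'); auto;
    try lra; try (unfold side; tauto).
  - now apply orthonormal_oppl, orthonormal_oppr.
  - intros Y HY. apply inside_between; [exact HC|]. apply on_open_seg_sym in HY. tauto.
  - intros Y Y' HY HY'. apply inside_between; [exact HC|]. apply on_open_seg_sym in HY. tauto.
  - destruct (flight P S u w L (L * M / sin (A + de)) (- de)
      (L * M' / sin (al' + - A)) al' A) as (d & Hd & Ed).
    + exact ES.
    + replace (A - - de) with (A + de) by ring. change (al' - A) with (al' + - A). lra.
    + lra.
    + pose proof (COS_bound (- de)). pose proof (COS_bound al'). nra.
    + exists d. split; [exact Hd|]. rewrite <- Ef. unfold X. rewrite <- Ed.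
      unfold ray. rewrite fr_oppr, fr_oppl. replace (PI - - al') with (al' + PI) by ring.
      rewrite fr_add_PI. apply pt_eq; unfold Rminus, padd, popp, pscale; simpl; ring.
Qed.

(** The path crosses the diagonal, so it bounces off [S T] first and off [S Q] second. *)
Lemma diag_state_flip (P Q S T u w : pt) (L al de al' de' p q m k B A M A' M' : R) :
  diag_quad P Q S T u w L al de al' de' p q m k ->
  m / 2 <= L <= 4 -> 4 * B <= k -> 32 * B < k * m -> B <= 1 / 16 ->
  Rabs p <= B -> Rabs q <= B ->
  A' = - A + 2 * q -> M' = sin A - M ->
  0 < M <= B -> 0 < M' <= B -> Rabs A <= B ->
  bounces P Q S T (diag_state P u w L de A M) (diag_state S (popp u) w L al' A' M').
Proof.
  intros (HC & HO & ES & (l1 & Hl1 & EQ) & (l2 & Hl2 & ET) & (l3 & Hl3 & EQ') & (l4 & Hl4 & ET')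
    & Hp & Hq & (Ka & Ka') & (Kd & Kd') & (Kb & Kb') & (Kc & Kc'))
    HL HB HBm HB' Bp Bq EA EM HM HM' HA.
  assert (HA2 : Rabs A <= k / 2) by lra.
  assert (S1 := sin_perturb k de A Kd HA2). assert (S2 := sin_perturb k de' A Kc HA2).
  rewrite Rplus_comm in S1.
  assert (C3 : / 2 <= cos A) by (apply cos_ge_half; lra).
  assert (T1 := diag_flight_room L M _ k B m HL HM ltac:(lra) HBm S1).
  assert (T2 := diag_flight_room L M' _ k B m HL HM' ltac:(lra) HBm S2).
  assert (E1 : L * M / sin (A + de) * sin (A + de) = L * M) by (field; lra).
  assert (E2 : L * M' / sin (de' + A) * sin (de' + A) = L * M') by (field; lra).
  assert (E3 : L * M' = L * sin A - L * M) by (rewrite EM; ring).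
  set (X := ray P u w (L * M / sin (A + de)) (- de)).
  assert (OX : on_open_seg P Q X) by (rewrite EQ; apply ray_on_open_seg; lra).
  assert (Ef : fr u w A = fr (popp u) w (PI + - A)) by (rewrite fr_oppl; f_equal; ring).
  rewrite ray_opp_r in EQ'. rewrite ray_opp_r, Ropp_involutive in ET'.
  unfold diag_state at 1. fold X. rewrite EA, Ef.
  apply (diag_turn P Q S T S T Q (popp u) w X L l4 l3 m k B de' al' q (- A) M'); auto;
    try lra; try (unfold side; tauto).
  - now apply orthonormal_oppl.
  - intros Y HY. apply inside_between; [exact HC|]. tauto.
  - intros Y Y' HY HY'. apply inside_between; [exact HC|]. apply on_open_seg_sym in HY'. tauto.
  - now rewrite Rabs_Ropp.
  - destruct (flight P S u w L (L * M / sin (A + de)) (- de)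
      (L * M' / sin (de' + A)) (- de') A) as (d & Hd & Ed).
    + exact ES.
    + replace (A - - de) with (A + de) by ring. replace (- de' - A) with (- (de' + A)) by ring.
      rewrite sin_neg. lra.
    + lra.
    + pose proof (COS_bound (- de)). pose proof (COS_bound (- de')). nra.
    + exists d. split; [exact Hd|]. rewrite <- Ef. unfold X. rewrite <- Ed.
      unfold ray. rewrite fr_oppl. replace (PI - de') with (- de' + PI) by ring.
      replace (de' - - A) with (de' + A) by ring.
      rewrite fr_add_PI. apply pt_eq; unfold padd, popp, pscale; simpl; ring.
Qed.

Lemma bounces_mirror (P Q S T : pt) s s' : bounces P T S Q s s' -> bounces P Q S T s s'.
Proof.
  apply clos_trans_mono. intros. now apply bounce_rotate, bounce_reverse.
Qed.

Lemma bounces_swap (P Q S T : pt) s s' : bounces S T P Q s s' -> bounces P Q S T s s'.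
Proof.
  apply clos_trans_mono. intros. now do 2 apply bounce_rotate.
Qed.

(** The orientation of the frame records [s]. The half turn [HS], the mirror image [HM] and their
    composite [HSM] reduce the eight cases to one lemma for each kind of step. *)
Lemma closed_orbit_diag (P Q S T u w : pt) (L al de al' de' p q m k B : R) :
  diag_quad P Q S T u w L al de al' de' p q m k ->
  m / 2 <= L <= 4 -> 4 * B <= k -> 32 * B < k * m -> B <= 1 / 16 ->
  Rabs p <= B -> Rabs q <= B ->
  pocket_orbit p q B -> closed_orbit P Q S T.
Proof.
  intros HD HL HB HBm HB' Hp Hq [x Hx].
  set (f := fun x : pocket_state => match x with (b, s, A, M) =>
    if b then if s then diag_state S (popp u) (popp w) L de' A M
              else diag_state S (popp u) w L al' A M
    else if s then diag_state P u w L de A M else diag_state P u (popp w) L al A M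
    end).
  exists (f x). revert Hx. apply clos_trans_map.
  assert (HM := diag_quad_mirror _ _ _ _ _ _ _ _ _ _ _ _ _ _ _ HD).
  assert (HS := diag_quad_swap _ _ _ _ _ _ _ _ _ _ _ _ _ _ _ HD).
  assert (HSM := diag_quad_mirror _ _ _ _ _ _ _ _ _ _ _ _ _ _ _ HS).
  rewrite popp_popp in HSM.
  intros _ _ [[] [] A M A' M' EA EM HM1 HM' HA HA' | [] [] A M A' M' EA EM HM1 HM' HA HA']; simpl.
  - apply bounces_swap. pose proof (diag_state_same _ _ _ _ _ _ _ _ _ _ _ _ _ _ _ B A M A' M' HS) as K.
    rewrite ?popp_popp in K. now apply K.
  - apply bounces_swap, bounces_mirror.
    pose proof (diag_state_same _ _ _ _ _ _ _ _ _ _ _ _ _ _ _ B A M A' M' HSM) as K.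
    rewrite ?popp_popp in K. now apply K.
  - pose proof (diag_state_same _ _ _ _ _ _ _ _ _ _ _ _ _ _ _ B A M A' M' HD) as K. now apply K.
  - apply bounces_mirror.
    pose proof (diag_state_same _ _ _ _ _ _ _ _ _ _ _ _ _ _ _ B A M A' M' HM) as K.
    rewrite ?popp_popp in K. now apply K.
  - apply bounces_swap. pose proof (diag_state_flip _ _ _ _ _ _ _ _ _ _ _ _ _ _ _ B A M A' M' HS) as K.
    rewrite ?popp_popp in K. now apply K.
  - apply bounces_swap, bounces_mirror.
    pose proof (diag_state_flip _ _ _ _ _ _ _ _ _ _ _ _ _ _ _ B A M A' M' HSM) as K.
    rewrite ?popp_popp in K. now apply K.
  - pose proof (diag_state_flip _ _ _ _ _ _ _ _ _ _ _ _ _ _ _ B A M A' M' HD) as K. now apply K.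
  - apply bounces_mirror.
    pose proof (diag_state_flip _ _ _ _ _ _ _ _ _ _ _ _ _ _ _ B A M A' M' HM) as K.
    rewrite ?popp_popp in K. now apply K.
Qed.

(** * Quadrilaterals close to rectangles *)

(* [o = -1] makes [dir o] run clockwise. *)
Definition dir (o theta : R) : pt := (cos theta, o * sin theta).

(** A closed polygon given by side lengths and directions: at each vertex the direction turns by the
    exterior angle, which is [PI / 2] plus the deficit. *)
Definition near_rect (o : R) (P Q S T : pt) (p q s t m e : R) : Prop :=
  p + q + s + t = 0 /\ Rabs p <= e /\ Rabs q <= e /\ Rabs s <= e /\ Rabs t <= e /\
  exists tau l1 l2 l3 l4,
    (m <= l1 <= 3 / 2 /\ m <= l2 <= 3 / 2 /\ m <= l3 <= 3 / 2 /\ m <= l4 <= 3 / 2) /\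
    Q = padd P (pscale l1 (dir o tau)) /\
    S = padd Q (pscale l2 (dir o (tau + PI / 2 + q))) /\
    T = padd S (pscale l3 (dir o (tau + PI + q + s))) /\
    P = padd T (pscale l4 (dir o (tau + 3 * (PI / 2) + q + s + t))).

Lemma dir_add_PI (o x : R) : dir o (x + PI) = popp (dir o x).
Proof.
  unfold dir. rewrite neg_cos, neg_sin. apply pt_eq; unfold popp, pscale; simpl; ring.
Qed.

Lemma dir_opp (o x : R) : dir (- o) x = dir o (- x).
Proof. unfold dir. rewrite cos_neg, sin_neg. apply pt_eq; simpl; ring. Qed.

Lemma padd_popp (P Q v : pt) (l : R) :
  Q = padd P (pscale l v) -> P = padd Q (pscale l (popp v)).
Proof. intros ->. apply pt_eq; unfold padd, popp, pscale; simpl; ring. Qed.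

Lemma near_rect_rotate (o : R) (P Q S T : pt) (p q s t m e : R) :
  near_rect o P Q S T p q s t m e -> near_rect o Q S T P q s t p m e.
Proof.
  intros (H & Hp & Hq & Hs & Ht & tau & l1 & l2 & l3 & l4 & HL & E1 & E2 & E3 & E4).
  split; [lra|]. do 4 (split; [assumption|]).
  exists (tau + PI / 2 + q), l2, l3, l4, l1. split; [tauto|]. split; [exact E2|].
  replace (tau + PI / 2 + q + PI / 2 + s) with (tau + PI + q + s) by field.
  replace (tau + PI / 2 + q + PI + s + t) with (tau + 3 * (PI / 2) + q + s + t) by field.
  replace (tau + PI / 2 + q + 3 * (PI / 2) + s + t + p) with (tau + PI + PI) by lra.
  rewrite !dir_add_PI, popp_popp. auto.
Qed.

Lemma near_rect_reverse (o : R) (P Q S T : pt) (p q s t m e : R) :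
  near_rect o P Q S T p q s t m e -> near_rect (- o) Q P T S q p t s m e.
Proof.
  intros (H & Hp & Hq & Hs & Ht & tau & l1 & l2 & l3 & l4 & HL & E1 & E2 & E3 & E4).
  split; [lra|]. do 4 (split; [assumption|]).
  exists (- (tau + PI)), l1, l4, l3, l2. split; [tauto|]. rewrite !dir_opp.
  replace (- - (tau + PI)) with (tau + PI) by ring.
  replace (- (- (tau + PI) + PI / 2 + p)) with (tau + 3 * (PI / 2) + q + s + t + PI - 2 * PI)
    by lra.
  replace (- (- (tau + PI) + PI + p + t)) with (tau + PI + q + s + PI - 2 * PI) by lra.
  replace (- (- (tau + PI) + 3 * (PI / 2) + p + t + s)) with (tau + PI / 2 + q + PI - 2 * PI)
    by lra.
  assert (K : forall x, dir o (x + PI - 2 * PI) = popp (dir o x)).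
  { intros x. rewrite <- (popp_popp (dir o (x + PI - 2 * PI))), <- dir_add_PI.
    do 2 f_equal. ring. }
  rewrite !K, dir_add_PI.
  repeat split; now apply padd_popp.
Qed.

Lemma cos_near_half (x e : R) : e <= 1 / 2 -> Rabs x <= e -> / 2 <= cos x.
Proof. intros He Hx. apply cos_ge_half. lra. Qed.

(** The two cross products are [l1 * l2 * cos q] and [l1 * l4 * cos p]. Rotation yields the other
    six inequalities of [convex]. *)
Lemma near_rect_left_of (o : R) (P Q S T : pt) (p q s t m e : R) :
  (o = 1 \/ o = -1) -> 0 < m -> e <= 1 / 2 ->
  near_rect o P Q S T p q s t m e -> left_of o P Q S /\ left_of o P Q T.
Proof.
  intros Ho Hm He (H & Hp & Hq & Hs & Ht & tau & l1 & l2 & l3 & l4 & HL & E1 & E2 & E3 & E4).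
  assert (Cq := cos_near_half q e He Hq). assert (Cp := cos_near_half p e He Hp).
  assert (Oo : o * o = 1) by (destruct Ho as [-> | ->]; ring).
  assert (K : forall x l, o * cross (pscale l1 (dir o tau)) (pscale l (dir o (tau + x)))
      = l1 * l * sin x).
  { intros x l. rewrite <- (Rplus_minus_l tau x) at 2. rewrite sin_minus.
    transitivity (o * o * (l1 * l * (sin (tau + x) * cos tau - cos (tau + x) * sin tau)));
      [unfold cross, dir, pscale; simpl; ring | rewrite Oo; ring]. }
  assert (ET : T = padd P (pscale l4 (dir o (tau + (PI / 2 - p))))).
  { replace (tau + 3 * (PI / 2) + q + s + t) with (tau + (PI / 2 - p) + PI) in E4 by lra.
    rewrite dir_add_PI in E4. apply padd_popp in E4. now rewrite popp_popp in E4. }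
  unfold left_of. split.
  - replace (o * cross (psub Q P) (psub S P)) with (l1 * l2 * cos q).
    + repeat apply Rmult_lt_0_compat; lra.
    + rewrite cos_sin, <- K, <- Rplus_assoc, E2, E1.
      unfold cross, psub, padd, pscale; simpl; ring.
  - replace (o * cross (psub Q P) (psub T P)) with (l1 * l4 * cos p).
    + repeat apply Rmult_lt_0_compat; lra.
    + rewrite <- sin_shift, <- K, ET, E1.
      unfold cross, psub, padd, pscale; simpl; ring.
Qed.

Lemma near_rect_convex (o : R) (P Q S T : pt) (p q s t m e : R) :
  (o = 1 \/ o = -1) -> 0 < m -> e <= 1 / 2 ->
  near_rect o P Q S T p q s t m e -> convex P Q S T.
Proof.
  intros Ho Hm He H1. assert (H2 := near_rect_rotate _ _ _ _ _ _ _ _ _ _ _ H1).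
  assert (H3 := near_rect_rotate _ _ _ _ _ _ _ _ _ _ _ H2).
  assert (H4 := near_rect_rotate _ _ _ _ _ _ _ _ _ _ _ H3).
  apply near_rect_left_of in H1, H2, H3, H4; auto. exists o. tauto.
Qed.

Lemma polar (x y : R) : 0 < x -> 0 < y ->
  exists L theta, 0 < L /\ x = L * cos theta /\ y = L * sin theta.
Proof.
  intros Hx Hy. exists (x / cos (atan (y / x))), (atan (y / x)).
  assert (C : 0 < cos (atan (y / x))) by (destruct (atan_bound (y / x)); apply cos_gt_0; lra).
  split; [now apply Rdiv_lt_0_compat|]. split; [field; lra|].
  transitivity (x * tan (atan (y / x))); [rewrite tan_atan; field; lra | unfold tan; field; lra].
Qed.

Lemma fr_dir (o psi theta : R) :
  fr (dir o psi) (- sin psi, o * cos psi) theta = dir o (psi + theta).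
Proof.
  unfold fr, dir. rewrite cos_plus, sin_plus.
  apply pt_eq; unfold padd, pscale; simpl; ring.
Qed.

Lemma orthonormal_dir (o psi : R) :
  (o = 1 \/ o = -1) -> orthonormal (dir o psi) (- sin psi, o * cos psi).
Proof.
  intros Ho. pose proof (sin2_cos2 psi) as K. unfold Rsqr in K.
  assert (Oo : o * o = 1) by (destruct Ho as [-> | ->]; ring).
  unfold orthonormal, dot, dir; simpl. repeat split.
  - replace (o * sin psi * (o * sin psi)) with (o * o * (sin psi * sin psi)) by ring.
    rewrite Oo. lra.
  - replace (o * cos psi * (o * cos psi)) with (o * o * (cos psi * cos psi)) by ring.
    rewrite Oo. lra.
  - replace (_ + _) with ((o * o - 1) * (sin psi * cos psi)) by ring. rewrite Oo. ring.
Qed.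

Lemma closed_orbit_near_side (o : R) (P Q S T : pt) (p q s t m e B : R) :
  (o = 1 \/ o = -1) -> 0 < m -> e <= B -> 8 * B < m -> B <= 1 / 16 ->
  near_rect o P Q S T p q s t m e -> pocket_orbit p q B -> closed_orbit P Q S T.
Proof.
  intros Ho Hm He HB HB' HN.
  assert (HC : convex P Q S T) by (apply (near_rect_convex o P Q S T p q s t m e); auto; lra).
  destruct HN as (H & Hp & Hq & Hs & Ht & tau & l1 & l2 & l3 & l4 & HL & E1 & E2 & E3 & E4).
  apply (closed_orbit_side P Q S T (dir o tau) (- sin tau, o * cos tau) l1 l4 l2 m); auto; try lra.
  - now apply orthonormal_dir.
  - unfold ray. rewrite fr_dir.
    replace (tau + 3 * (PI / 2) + q + s + t) with (tau + (PI / 2 - p) + PI) in E4 by lra.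
    rewrite dir_add_PI in E4. apply padd_popp in E4. now rewrite popp_popp in E4.
  - unfold ray. rewrite fr_oppl, fr_dir.
    replace (tau + (PI - (PI / 2 - q))) with (tau + PI / 2 + q) by field. exact E2.
Qed.

Lemma closed_orbit_near_diag (o : R) (P Q S T : pt) (p q s t m e B : R) :
  (o = 1 \/ o = -1) -> 0 < m <= 1 -> 32 * e <= B -> 512 * B < m * m ->
  near_rect o P Q S T p q s t m e -> pocket_orbit p s B -> closed_orbit P Q S T.
Proof.
  intros Ho Hm He HB HN.
  assert (HB' : 512 * B < m) by nra.
  assert (HC : convex P Q S T).
  { apply (near_rect_convex o P Q S T p q s t m e); auto; [lra|].
    destruct HN as (_ & Hp & _). pose proof (Rabs_pos p). lra. }
  destruct HN as (H & Hp & Hq & Hs & Ht & tau & l1 & l2 & l3 & l4 & HL & E1 & E2 & E3 & E4).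
  assert (He' : 0 <= e) by (pose proof (Rabs_pos p); lra).
  assert (Cq : / 2 <= cos q) by (apply (cos_near_half q e); lra).
  assert (Sq := Rabs_bounds _ _ (Rle_trans _ _ _ (sin_le_abs q) Hq)).
  (* Coordinates of [S] in the frame at [P] along [P Q]. Their polar form gives the length [L] of
     the diagonal and its angle [de] with [P Q]. *)
  assert (HX : m / 2 <= l1 - l2 * sin q <= 2) by (split; nra).
  assert (HY : m / 2 <= l2 * cos q <= 3 / 2) by (pose proof (COS_bound q); split; nra).
  destruct (polar (l1 - l2 * sin q) (l2 * cos q)) as (L & de & HL0 & EC & ES); [lra | lra |].
  assert (CB := COS_bound de). assert (SB := SIN_bound de).
  assert (HLu : L <= 4).
  { assert (L = L * cos de * cos de + L * sin de * sin de).
    { pose proof (sin2_cos2 de) as K. unfold Rsqr in K.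
      transitivity (L * (sin de * sin de + cos de * cos de)); [rewrite K|]; ring. }
    rewrite <- EC, <- ES in H0. nra. }
  assert (HLl : m / 2 <= L) by nra.
  assert (K1 : m / 8 <= sin de) by nra.
  assert (K2 : m / 8 <= cos de) by nra.
  apply Rabs_bounds in Hp as Hp', Hq as Hq', Hs as Hs', Ht as Ht'.
  (* All four angles at the diagonal are [de + y] or its complement with [y] at most [2 * e] in
     absolute value. Hence [k = m / 16], and [512 * B < m * m] is [32 * B < k * m]. *)
  assert (KK : forall y, - (2 * e) <= y <= 2 * e ->
    (m / 16 <= sin (de + y) /\ m / 16 <= cos (de + y))).
  { intros y Hy. replace (m / 16) with (m / 8 / 2) by field.
    split; [apply sin_perturb | apply cos_perturb]; auto; apply Rabs_le; lra. }
  assert (KC : forall y, - (2 * e) <= y <= 2 * e ->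
    (m / 16 <= sin (PI / 2 - (de + y)) /\ m / 16 <= cos (PI / 2 - (de + y)))).
  { intros y Hy. rewrite sin_shift, cos_shift. destruct (KK y Hy). auto. }
  assert (HS : S = padd P (pscale L (dir o (tau + de)))).
  { rewrite E2, E1. unfold dir. rewrite Rplus_assoc.
    replace (PI / 2 + q) with (PI / 2 - - q) by ring.
    rewrite !(cos_plus tau), !(sin_plus tau), cos_shift, sin_shift, cos_neg, sin_neg.
    apply pt_eq; unfold padd, pscale; simpl.
    - transitivity (fst P + (L * cos de * cos tau - L * sin de * sin tau)); [|ring].
      rewrite <- EC, <- ES. ring.
    - transitivity (snd P + o * (L * cos de * sin tau + L * sin de * cos tau)); [|ring].
      rewrite <- EC, <- ES. ring. }
  (* The triangle [P Q S] has angle [PI / 2 - q] at [Q], which gives the third angle; the second and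
     fourth complete the interior angles at [P] and [S]. *)
  apply (closed_orbit_diag P Q S T (dir o (tau + de)) (- sin (tau + de), o * cos (tau + de)) L
    (PI / 2 - (de + p)) de (PI / 2 - (de - q)) (de - q - s) p s m (m / 16)); try lra.
  assert (EP : forall x, fr (popp (dir o (tau + de))) (popp (- sin (tau + de), o * cos (tau + de))) x
     = popp (dir o (tau + de + x))).
  { intros x. rewrite fr_oppr, fr_oppl, fr_dir.
    replace (tau + de + (PI - - x)) with (tau + de + x + PI) by ring. apply dir_add_PI. }
  unfold diag_quad, ray. rewrite !fr_dir, !EP.
  split; [exact HC|]. split; [now apply orthonormal_dir|]. split; [exact HS|].
  repeat split.
  - exists l1. split; [lra|]. rewrite E1. do 3 f_equal. ring.
  - exists l4. split; [lra|].
    replace (tau + 3 * (PI / 2) + q + s + t) with (tau + de + (PI / 2 - (de + p)) + PI) in E4 by lra.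
    rewrite dir_add_PI in E4. apply padd_popp in E4. now rewrite popp_popp in E4.
  - exists l2. split; [lra|].
    replace (tau + de + (PI / 2 - (de - q))) with (tau + PI / 2 + q) by ring.
    now apply padd_popp.
  - exists l3. split; [lra|]. rewrite <- dir_add_PI.
    replace (tau + de + - (de - q - s) + PI) with (tau + PI + q + s) by ring. exact E3.
  - lra.
  - lra.
  - apply KC; lra.
  - apply KC; lra.
  - lra.
  - lra.
  - apply (KC (- q)); lra.
  - apply (KC (- q)); lra.
  - replace (de - q - s) with (de + (- q - s)) by ring. apply KK; lra.
  - replace (de - q - s) with (de + (- q - s)) by ring. apply KK; lra.
Qed.

Lemma closed_orbit_near_acute (o : R) (P Q S T : pt) (p q s t m e : R) :
  (o = 1 \/ o = -1) -> 0 < m <= 1 -> 32 * 1024 * e <= m * m ->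
  near_rect o P Q S T p q s t m e -> 0 <= p -> (p = 0 -> q = 0) -> closed_orbit P Q S T.
Proof.
  intros Ho Hm He HN Hp0 Hz. set (B := m * m / 1024).
  assert (HB : 0 < B /\ 8 * B < m /\ B <= 1 / 16 /\ 512 * B < m * m) by (unfold B; repeat split; nra).
  assert (HB' : 32 * e <= B) by (unfold B; lra).
  pose proof HN as (H & Hp & Hq & Hs & Ht & _).
  apply Rabs_bounds in Hp, Hq, Hs, Ht.
  destruct (Rle_lt_dec (- p / 3) q) as [Lq|Lq].
  { apply (closed_orbit_near_side o P Q S T p q s t m e B); auto; try lra.
    apply pocket_orbit_exists; lra. }
  assert (p <> 0) by (intros E; specialize (Hz E); lra).
  destruct (Rle_lt_dec (- p / 3) t) as [Lt|Lt].
  { apply closed_orbit_rotate, closed_orbit_reverse.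
    apply (closed_orbit_near_side (- o) P T S Q p t s q m e B); auto; try lra.
    - now apply near_rect_reverse, near_rect_rotate, near_rect_rotate, near_rect_rotate.
    - apply pocket_orbit_exists; lra. }
  (* Both [q] and [t] are below [- p / 3], so [s = - (p + q + t)] exceeds [- p / 3]. *)
  apply (closed_orbit_near_diag o P Q S T p q s t m e B); auto; try lra.
  apply pocket_orbit_exists; lra.
Qed.

Lemma closed_orbit_near_rect (o : R) (P Q S T : pt) (p q s t m e : R) :
  (o = 1 \/ o = -1) -> 0 < m <= 1 -> 32 * 1024 * e <= m * m ->
  near_rect o P Q S T p q s t m e -> closed_orbit P Q S T.
Proof.
  intros Ho Hm He H1. assert (H2 := near_rect_rotate _ _ _ _ _ _ _ _ _ _ _ H1).
  assert (H3 := near_rect_rotate _ _ _ _ _ _ _ _ _ _ _ H2).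
  assert (H4 := near_rect_rotate _ _ _ _ _ _ _ _ _ _ _ H3).
  pose proof H1 as (HE & _).
  destruct (Rlt_le_dec 0 q) as [Lq|Lq].
  { do 3 apply closed_orbit_rotate.
    apply (closed_orbit_near_acute o Q S T P q s t p m e); auto; lra. }
  destruct (Rlt_le_dec 0 s) as [Ls|Ls].
  { do 2 apply closed_orbit_rotate.
    apply (closed_orbit_near_acute o S T P Q s t p q m e); auto; lra. }
  destruct (Rlt_le_dec 0 t) as [Lt|Lt].
  { apply closed_orbit_rotate.
    apply (closed_orbit_near_acute o T P Q S t p q s m e); auto; lra. }
  (* Now [q], [s], [t] are at most 0; so [p >= 0], and [p = 0] forces all of them to vanish. *)
  apply (closed_orbit_near_acute o P Q S T p q s t m e); auto; lra.
Qed.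

(** * From the angle parameters to side lengths and deficits *)

Lemma law_of_sines_bounds (x y m e : R) :
  m <= sin x -> 0 < m -> e <= 1 / 3 -> Rabs (x + y - PI / 2) <= e ->
  2 / 3 <= sin (x + y) /\ m <= sin x / sin (x + y) <= 3 / 2.
Proof.
  intros Hx Hm He H.
  assert (S : 2 / 3 <= sin (x + y)).
  { pose proof (sin_lipschitz (x + y) (PI / 2)) as K. rewrite sin_PI2 in K.
    apply (fun a => Rle_trans _ _ _ a H), Rabs_bounds in K. lra. }
  pose proof (SIN_bound (x + y)). pose proof (SIN_bound x).
  assert (E : sin x / sin (x + y) * sin (x + y) = sin x) by (field; lra).
  split; [exact S|]. set (r := sin x / sin (x + y)) in *. split; nra.
Qed.

Lemma near_rect_of_angles (a0 b0 a b c d m e : R) :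
  a0 + b0 = PI / 2 -> 0 < m -> 2 * m <= sin a0 -> 2 * m <= sin b0 -> e <= m -> e <= 1 / 3 ->
  Rabs (a - a0) <= e / 2 -> Rabs (b - b0) <= e / 2 ->
  Rabs (c - a0) <= e / 2 -> Rabs (d - b0) <= e / 2 ->
  near_rect (-1) vA (vB a b) vC (vD c d)
    (PI / 2 - a - d) (a + b - PI / 2) (PI / 2 - b - c) (c + d - PI / 2) m e.
Proof.
  intros H0 Hm Sa0 Sb0 He He' Ha Hb Hc Hd.
  assert (LS : forall x y, Rabs (x - y) <= e / 2 -> 2 * m <= sin y -> m <= sin x).
  { intros x y Hxy Hy. pose proof (Rle_trans _ _ _ (sin_lipschitz x y) Hxy) as K.
    apply Rabs_bounds in K. lra. }
  assert (Sa := LS _ _ Ha Sa0). assert (Sb := LS _ _ Hb Sb0).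
  assert (Sc := LS _ _ Hc Sa0). assert (Sd := LS _ _ Hd Sb0). clear LS.
  apply Rabs_bounds in Ha, Hb, Hc, Hd.
  destruct (law_of_sines_bounds a b m e) as [S1 B1]; auto; [apply Rabs_le; lra|].
  destruct (law_of_sines_bounds b a m e) as [_ B2]; auto; [apply Rabs_le; lra|].
  destruct (law_of_sines_bounds c d m e) as [S3 B3]; auto; [apply Rabs_le; lra|].
  destruct (law_of_sines_bounds d c m e) as [_ B4]; auto; [apply Rabs_le; lra|].
  rewrite (Rplus_comm b a) in B2. rewrite (Rplus_comm d c) in B4.
  split; [lra|]. do 4 (split; [apply Rabs_le; lra|]).
  (* The direction of AB is written [- a] because [dir (-1)] runs clockwise; the lengths come from
     the law of sines in the two triangles. *)
  exists (- a), (sin b / sin (a + b)), (sin a / sin (a + b)), (sin d / sin (c + d)),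
    (sin c / sin (c + d)).
  split; [tauto|]. unfold dir.
  replace (- a + PI / 2 + (a + b - PI / 2)) with b by ring.
  replace (- a + PI + (a + b - PI / 2) + (PI / 2 - b - c)) with (- c + PI) by field.
  replace (- a + 3 * (PI / 2) + (a + b - PI / 2) + (PI / 2 - b - c) + (c + d - PI / 2))
    with (d + PI) by field.
  rewrite !neg_cos, !neg_sin, !cos_neg, !sin_neg.
  unfold vA, vB, vC, vD. repeat split; apply pt_eq; unfold padd, pscale; simpl; try ring;
    rewrite ?(sin_plus a b), ?(sin_plus c d) in *; field; lra.
Qed.

Theorem theorem1 (a0 b0 c0 d0 : R) :
  in_Q a0 b0 c0 d0 -> is_rectangle a0 b0 c0 d0 ->
  exists U : R -> R -> R -> R -> Prop,
    (* U is open in R^4 *)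
    (forall a b c d, U a b c d ->
       exists eps, 0 < eps /\
         forall a' b' c' d', Rabs (a' - a) < eps -> Rabs (b' - b) < eps ->
           Rabs (c' - c) < eps -> Rabs (d' - d) < eps -> U a' b' c' d') /\
    U a0 b0 c0 d0 /\
    forall a b c d, in_Q a b c d -> U a b c d -> has_periodic_billiard_path a b c d.
Proof.
  intros (Ha & Hb & _) (<- & <- & H0).
  (* Half the minimum, so that the sines stay above [m] when the angles move by [e / 2]. *)
  set (m := Rmin (sin a0) (sin b0) / 2).
  assert (Sa : 0 < sin a0) by (apply sin_gt_0; lra).
  assert (Sb : 0 < sin b0) by (apply sin_gt_0; lra).
  assert (Hm : 0 < m <= 1 / 2 /\ 2 * m <= sin a0 /\ 2 * m <= sin b0).
  { pose proof (SIN_bound a0). unfold m, Rmin. destruct Rle_dec; lra. }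
  (* The factor 32 is the ratio [B / e] that the pocket orbits require, and [m * m / 1024] is the
     bound [B]. Each deficit involves two angles, hence the radius [e / 2] below. *)
  clearbody m. set (e := m * m / (32 * 1024)).
  assert (He : 0 < e /\ e <= m /\ e <= 1 / 3) by (unfold e; repeat split; nra).
  exists (fun a b c d => Rabs (a - a0) < e / 2 /\ Rabs (b - b0) < e / 2 /\
    Rabs (c - a0) < e / 2 /\ Rabs (d - b0) < e / 2).
  split; [|split].
  - intros a b c d (Ua & Ub & Uc & Ud).
    set (M := Rmax (Rmax (Rabs (a - a0)) (Rabs (b - b0))) (Rmax (Rabs (c - a0)) (Rabs (d - b0)))).
    assert (HM : Rabs (a - a0) <= M /\ Rabs (b - b0) <= M /\ Rabs (c - a0) <= M /\
      Rabs (d - b0) <= M /\ M < e / 2).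
    { unfold M, Rmax. repeat destruct Rle_dec; lra. }
    clearbody M. exists (e / 2 - M). split; [lra|].
    assert (K : forall x' x y, Rabs (x' - x) < e / 2 - M -> Rabs (x - y) <= M ->
      Rabs (x' - y) < e / 2).
    { intros x' x y H1 H2. replace (x' - y) with ((x' - x) + (x - y)) by ring.
      pose proof (Rabs_triang (x' - x) (x - y)). lra. }
    intros a' b' c' d' Ha' Hb' Hc' Hd'.
    split; [now apply (K a' a)|]. split; [now apply (K b' b)|].
    split; [now apply (K c' c) | now apply (K d' d)].
  - rewrite !Rminus_diag, Rabs_R0. lra.
  - intros a b c d HQ (Ua & Ub & Uc & Ud). apply periodic_of_closed_orbit; [exact HQ|].
    apply (closed_orbit_near_rect (-1) _ _ _ _ (PI / 2 - a - d) (a + b - PI / 2)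
      (PI / 2 - b - c) (c + d - PI / 2) m e); [now right | lra | unfold e; lra |].
    apply (near_rect_of_angles a0 b0); lra.
Qed.
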